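(* Let $0<\alpha\le1$ and let $\{\mathcal{S}^\alpha(t)\}_{t\ge0}$ be the generalized fractional Skellam process with rates $\lambda_j,\mu_j>0$, $j=1,\dots,k$. Then its moment generating function $\mathcal{M}_{\mathcal{S}^\alpha}(u,t)=\mathbb{E}(e^{u\mathcal{S}^\alpha(t)})$ is $$\mathcal{M}_{\mathcal{S}^\alpha}(u,t)=E_{\alpha,1}\Big(\sum_{j=1}^k\big(\lambda_j(e^{uj}-1)+\mu_j(e^{-uj}-1)\big)t^\alpha\Big),\qquad u\in\mathbb{R},$$ it satisfies $$\frac{\mathrm{d}^\alpha}{\mathrm{d}t^\alpha}\mathcal{M}_{\mathcal{S}^\alpha}(u,t)=\Big(\sum_{j=1}^k\big(\lambda_j(e^{uj}-1)+\mu_j(e^{-uj}-1)\big)\Big)\mathcal{M}_{\mathcal{S}^\alpha}(u,t),\qquad\mathcal{M}_{\mathcal{S}^\alpha}(u,0)=1,$$ where $\frac{\mathrm{d}^\alpha}{\mathrm{d}t^\alpha}$ is the Caputo fractional derivative, and for every integer $r\ge1$ $$\mathbb{E}\big((\mathcal{S}^\alpha(t))^r\big)=r!\sum_{n=1}^r\frac{t^{n\alpha}}{\Gamma(n\alpha+1)}\sum_{m_1+\dots+m_n=r,\ m_i\in\mathbb{N}}\ \prod_{l=1}^n\Big(\frac{1}{m_l!}\sum_{j=1}^k\big(j^{m_l}\lambda_j+(-1)^{m_l}j^{m_l}\mu_j\big)\Big),$$ where $\mathbb{N}=\{1,2,\dots\}$.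
   Context: Fix an integer $k\ge1$ and positive rates $\lambda_1,\dots,\lambda_k,\mu_1,\dots,\mu_k$. The generalized counting process (GCP) with rates $\lambda_1,\dots,\lambda_k$ is a Lévy process started at $0$ performing jumps of size $j\in\{1,\dots,k\}$ at rate $\lambda_j$. The generalized Skellam process (GSP) is $\mathcal{S}(t)=M_1(t)-M_2(t)$, with $M_1,M_2$ independent GCPs with rates $\lambda_j$ and $\mu_j$, respectively. For $0<\alpha<1$, the inverse stable subordinator is $Y_\alpha(t)=\inf\{x\ge0: D_\alpha(x)>t\}$, where $D_\alpha$ is the stable subordinator, $\mathbb{E}(e^{-sD_\alpha(t)})=e^{-ts^\alpha}$. The generalized fractional Skellam process (GFSP) is $\mathcal{S}^\alpha(t)=\mathcal{S}(Y_\alpha(t))$ for $0<\alpha<1$ with $\mathcal{S}$ and $Y_\alpha$ independent, and $\mathcal{S}^1(t)=\mathcal{S}(t)$. $E_{\alpha,1}(x)=\sum_{j\ge0}\frac{x^j}{\Gamma(j\alpha+1)}$ is the Mittag-Leffler function. *)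

(* Defs.v *)
From HB Require Import structures.
From mathcomp Require Export all_boot all_order all_algebra.
From mathcomp Require Export all_classical all_reals all_analysis.

Set Implicit Arguments.
Unset Strict Implicit.
Unset Printing Implicit Defensive.

Export Order.TTheory GRing.Theory Num.Theory.
Export numFieldNormedType.Exports.

Local Open Scope classical_set_scope.
Local Open Scope ring_scope.

(* A real-valued process indexed by [0, +oo[ is a function X : R -> T -> R;
   only the values X t with 0 <= t are ever constrained or used. *)

Section Processes.
Context d (T : measurableType d) (R : realType) (P : probability T R).
Implicit Types X Y D S : R -> T -> R.

Definition increment X (s t : R) : T -> R := fun w => X t w - X s w.

Definition cadlag (x : R -> R) : Prop :=
  (forall t : R, 0 <= t -> x s @[s --> t^'+] --> x t) /\
  (forall t : R, 0 < t -> cvg (x s @[s --> t^'-])).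

Definition independent_increments X : Prop :=
  forall (n : nat) (t : nat -> R) (B : nat -> set R),
    0 <= t 0 -> {homo t : i j / (i <= j)%N >-> i <= j} ->
    (forall i, measurable (B i)) ->
    P (\bigcap_(i < n) (increment X (t i) (t i.+1) @^-1` B i)) =
    (\prod_(i < n) P (increment X (t i) (t i.+1) @^-1` B i))%E.

Definition stationary_increments X : Prop :=
  forall (s h : R) (B : set R), 0 <= s -> 0 <= h -> measurable B ->
    P (increment X s (s + h) @^-1` B) = P (X h @^-1` B).

(* Stochastic continuity is not required separately: it follows from
   right-continuity at 0 and stationarity of the increments. *)
Record levy_process X : Prop := LevyProcess {
  levy_measurable : forall t : R, 0 <= t -> measurable_fun [set: T] (X t) ;
  levy_start : {ae P, forall w, X 0 w = 0} ;
  levy_independent : independent_increments X ;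
  levy_stationary : stationary_increments X ;
  levy_cadlag : forall w, cadlag (X ^~ w) }.

(* Jumps of size j at rate lam j, 1 <= j <= k, and no others:
     P(X h = j) = lam j * h + o(h)  and
     P(X h = 0) = 1 - (lam 1 + ... + lam k) * h + o(h)  as h -> 0+;
   hence P(X h is not in {0, ..., k}) = o(h). *)
Definition generalized_counting_process (k : nat) (lam : nat -> R) X : Prop :=
  [/\ levy_process X,
      forall j, (1 <= j <= k)%N ->
        fine (P [set w | X h w = j%:R]) / h @[h --> 0^'+] --> lam j &
      (1 - fine (P [set w | X h w = 0])) / h @[h --> 0^'+] -->
        \sum_(1 <= j < k.+1) lam j].

Definition process_sigma_algebra X : set (set T) :=
  <<s \bigcup_(t in [set t : R | 0 <= t])
        preimage_set_system [set: T] (X t) measurable >>.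

Definition independent_processes X Y : Prop :=
  forall A B, process_sigma_algebra X A -> process_sigma_algebra Y B ->
    P (A `&` B) = (P A * P B)%E.

Definition generalized_skellam_process (k : nat) (lam mu : nat -> R) S : Prop :=
  exists M1 M2 : R -> T -> R,
    [/\ generalized_counting_process k lam M1,
        generalized_counting_process k mu M2,
        independent_processes M1 M2 &
        forall (t : R) w, 0 <= t -> S t w = M1 t w - M2 t w].

Definition stable_subordinator (alpha : R) D : Prop :=
  [/\ levy_process D,
      forall w (s t : R), 0 <= s -> s <= t -> D s w <= D t w &
      forall s t : R, 0 <= s -> 0 <= t ->
        'E_P[fun w => expR (- (s * D t w))]%E = (expR (- (t * s `^ alpha)))%:E].

(* inf is the real infimum, so the value is 0 where the path of D never
   exceeds t; for a stable subordinator this is a null event. *)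
Definition inverse_subordinator D : R -> T -> R :=
  fun t w => inf [set x : R | 0 <= x /\ t < D x w].

Definition generalized_fractional_skellam_process (alpha : R) (k : nat)
    (lam mu : nat -> R) Sa : Prop :=
  exists2 S : R -> T -> R, generalized_skellam_process k lam mu S &
    if alpha == 1 then forall (t : R) w, 0 <= t -> Sa t w = S t w
    else exists D : R -> T -> R,
      [/\ stable_subordinator alpha D,
          independent_processes S (inverse_subordinator D) &
          forall (t : R) w, 0 <= t -> Sa t w = S (inverse_subordinator D t w) w].

End Processes.

Section SpecialFunctions.
Context (R : realType).
Implicit Types (alpha beta x t : R) (f : R -> R).

(* Euler's integral, meaningful for 0 < x. *)
Definition Gamma x : R :=
  \int[lebesgue_measure]_(s in `]0, +oo[) (s `^ (x - 1) * expR (- s)).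

Definition mittag_leffler alpha beta x : R :=
  limn (series (fun j : nat => x ^+ j / Gamma (j%:R * alpha + beta))).

(* Caputo derivative of order 0 < alpha <= 1 with base point 0, at 0 < t. *)
Definition caputo alpha f t : R :=
  if alpha == 1 then derive1 f t
  else (Gamma (1 - alpha))^-1 *
       \int[lebesgue_measure]_(s in `]0, t[) (derive1 f s * (t - s) `^ (- alpha)).

Definition caputo_derivable alpha f t : Prop :=
  if alpha == 1 then derivable f t 1
  else (forall s : R, 0 < s < t -> derivable f s 1) /\
       lebesgue_measure.-integrable `]0, t[
         (fun s => (derive1 f s * (t - s) `^ (- alpha))%:E).

Definition is_caputo alpha f t v : Prop :=
  caputo_derivable alpha f t /\ caputo alpha f t = v.

Definition skellam_exponent (k : nat) (lam mu : nat -> R) (u : R) : R :=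
  \sum_(1 <= j < k.+1)
    (lam j * (expR (u * j%:R) - 1) + mu j * (expR (- (u * j%:R)) - 1)).

End SpecialFunctions.

(* Main.v *)
Require Import Defs.
From mathcomp Require Import measurable_realfun ring lra.

Set Implicit Arguments.
Unset Strict Implicit.
Unset Printing Implicit Defensive.

Local Open Scope classical_set_scope.
Local Open Scope ring_scope.

(** For a generalized counting process, [X t] is the sum of its [n] increments
    over a grid of mesh [t / n]; truncated to the jump sizes [0, ..., k] these are
    i.i.d. and give a moment generating function of the form [(1 + x_n / n) ^ n],
    and a second-moment bound allows passing to the limit.  Independence then gives
    [E exp (u S_t) = exp (t psi u)] with [psi = skellam_exponent].  Rounding an
    independent random time [Y] up to a grid and using right-continuity of the paths
    yields [E exp (u S_Y) = E exp (psi u * Y)].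

    For the inverse stable subordinator, [D x] and [x ^ (1 / alpha) * D 1] have the
    same Laplace transform, hence the same law, so [Y_alpha t] is distributed as
    [(t / D 1) ^ alpha]; the negative moments of [D 1] are Gamma integrals, and
    [E (Y_alpha t) ^ n = n! t ^ (n alpha) / Gamma (n alpha + 1)] sums up to the
    Mittag-Leffler function.

    The Caputo derivative is computed term by term with Euler's Beta integral, by
    dominated convergence.  For the moments, the moment generating function is
    expanded modulo [u ^ (r + 1)] in two ways, by Taylor's formula under the
    expectation and by substituting the Taylor polynomial of [psi] into the
    Mittag-Leffler series; the coefficients of [u ^ r] agree. *)

(** * Gamma and Beta integrals *)

(** The counting process is known only through its jump rates, and exp(u X) is unbounded: an event
    of probability o(h) can still carry a large exponential. This forces the truncation, and with it
    a uniform integrability argument in the limit. The latter comes cheaply because the square of an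
    exponential functional at u is the same functional at 2 u, whose mean is already computed; the
    time change reuses this device.

    Laplace transforms are turned into laws through a moment problem on the unit interval: the
    powers of exp(- D) integrate to the Laplace transform of D at the integers, and Bernstein
    polynomials lead from these moments to tail probabilities. Tails, rather than variables, are
    compared for the inverse subordinator, since first passage only relates it to D up to strictness
    of inequalities and a null event.

    The moments avoid differentiating a composite series r times: two polynomials that agree up to
    O(u^(r+1)) have the same coefficient of u^r, and the sum over compositions is the coefficient of
    a power of a polynomial. *)

Section gamma.
Context {R : realType}.
Local Notation mu := (@lebesgue_measure R).

Lemma is_derive_continuous (f : R -> R) (x l : R) :
  is_derive x (1 : R) f l -> {for x, continuous f}.
Proof.
by move=> fl; apply: differentiable_continuous; apply/derivable1_diffP; case: fl.
Qed.

Lemma integral_expR_tail (c : R) :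
  (\int[mu]_(x in `]c, +oo[) (expR (- x))%:E = (expR (- c))%:E)%E.
Proof.
have d1 x : is_derive x (1 : R) (fun x : R => - expR (- x)) (expR (- x)).
  have d0 : is_derive x (1 : R) (fun x : R => expR (- x)) (- expR (- x)).
    have := @is_derive1_comp R expR -%R x (expR (- x)) (- 1) _ _.
    by rewrite mulrN1; apply.
  by apply: is_derive_eq; rewrite opprK.
have cE : continuous (fun x : R => expR (- x)).
  by move=> x; apply: continuous_comp; [exact: continuousN|exact: continuous_expR].
rewrite integral_itv_obnd_cbnd; last first.
  by apply/measurable_EFinP; apply: measurableT_comp => //; exact: measurable_funTS.
rewrite (@ge0_continuous_FTC2y R (fun x => expR (- x)) (fun x => - expR (- x)) c 0).
- by rewrite sub0e EFinN oppeK.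
- by move=> x _; exact: expR_ge0.
- exact: continuous_subspaceT.
- by rewrite -oppr0; apply: cvgN; exact: cvgr_expR.
- by move=> x _; case: (d1 x).
- by apply: cvg_at_right_filter; apply: is_derive_continuous (d1 c).
- by move=> x _; rewrite derive1E derive_val.
Qed.

Lemma integral_powR (a t : R) : 0 < a -> 0 < t ->
  (\int[mu]_(x in `]0%R, t[) (a * x `^ (a - 1))%:E = (t `^ a)%:E)%E.
Proof.
move=> a0 t0.
(* For [a < 1] the integrand is singular at 0, so the fundamental theorem of calculus is applied on
   [[e i, t]], and these intervals exhaust []0, t]]. The denominator starts at 2 so that [e i < t]
   already for [i = 0]. *)
pose e i : R := t / i.+2%:R.
have e0 i : 0 < e i by rewrite divr_gt0.
have et i : e i < t by rewrite ltr_pdivrMr// ltr_pMr// ltr1n.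
have dP (x : R) : 0 < x -> is_derive x (1 : R) (fun x => x `^ a) (a * x `^ (a - 1)).
  by move=> x0; exact: is_derive1_powR.
have cP (b x : R) : 0 < x -> {for x, continuous (fun x => x `^ b)}.
  by move=> x0; apply: is_derive_continuous (is_derive1_powR b x0).
have mf : measurable_fun [set: R] (fun x : R => (a * x `^ (a - 1))%:E).
  by apply/measurable_EFinP; apply: measurable_funM => //; exact: measurable_powR.
rewrite integral_itv_bndo_bndc; last exact: measurable_funTS.
have U : `]0%R, t]%classic = \bigcup_i `[e i, t]%classic.
  apply/seteqP; split => x /=; rewrite in_itv/=.
    move=> /andP[x0 xt]; exists (Num.truncn (t / x)) => //=; rewrite in_itv/= xt andbT.
    rewrite /e ler_pdivrMr// mulrC -ler_pdivrMr//.
    by rewrite (le_trans (ltW (truncnS_gt _)))// ler_nat.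
  move=> [i _] /=; rewrite in_itv/= => /andP[ex ->]; rewrite andbT.
  exact: lt_le_trans ex.
rewrite U.
have ne : {homo (fun i => `[e i, t]%classic) : n m / (n <= m)%N >-> (n <= m)%O}.
  move=> n m nm; apply/subsetPset => x /=; rewrite !in_itv/= => /andP[+ ->]; rewrite andbT.
  apply: le_trans; rewrite ler_pM2l// lef_pV2 ?posrE// ler_nat//.
apply: (@cvg_unique _ _ ((\int[mu]_(x in `[e i, t]) (a * x `^ (a - 1))%:E)%E @[i --> \oo])) => //.
  apply: ge0_nondecreasing_set_cvg_integral => //.
    by move=> i; exact: measurable_funTS.
  by move=> i x _; rewrite lee_fin mulr_ge0 ?powR_ge0 ?ltW.
rewrite (_ : (fun i => _) = (fun i => (t `^ a)%:E - (e i `^ a)%:E)%E); last first.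
  apply/funext => i; apply: (@continuous_FTC2 _ _ (fun x => x `^ a)) => //.
  - apply/continuous_within_itvP => //; split.
    + move=> x; rewrite in_itv/= => /andP[ex _].
      apply: cvgM; first exact: cvg_cst.
      by apply: cP; exact: lt_trans ex.
    + by apply: cvg_at_right_filter; apply: cvgM; [exact: cvg_cst|exact: cP].
    + by apply: cvg_at_left_filter; apply: cvgM; [exact: cvg_cst|exact: cP].
  - split.
    + move=> x; rewrite in_itv/= => /andP[ex _].
      by have [] := dP x (lt_trans (e0 i) ex).
    + by apply: cvg_at_right_filter; exact: cP.
    + by apply: cvg_at_left_filter; exact: cP.
  - move=> x; rewrite in_itv/= => /andP[ex _].
    by rewrite derive1E; have /@derive_val -> := dP x (lt_trans (e0 i) ex).
have e_cvg : e @ \oo --> 0.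
  rewrite -(mulr0 t); apply: cvgM; first exact: cvg_cst.
  by have := @cvg_harmonic R; rewrite -cvg_shiftS.
have := (cvg_at_rightP (fun x : R => x `^ a) 0 0).1 (powR_cvg0 a0) e (conj e0 e_cvg).
move=> ea0; apply: cvg_EFin; first exact: nearW.
rewrite -[X in _ --> X]subr0; apply: cvgB; [exact: cvg_cst|exact: ea0].
Qed.

Lemma ltr_powR_mono (r x y : R) : 0 < r -> 0 <= x -> 0 <= y ->
  (x `^ r < y `^ r) = (x < y).
Proof.
move=> r0 x0 y0; apply/idP/idP => [|xy]; last exact: gt0_ltr_powR.
by apply: contraTT; rewrite -!leNgt => yx; exact: ge0_ler_powR (ltW r0) _ _ _ _ yx.
Qed.

Lemma gt0_powRD (r s x : R) : 0 < x -> x `^ (r + s) = x `^ r * x `^ s.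
Proof. by move=> x0; rewrite powRD// (gt_eqF x0) implybT. Qed.

Lemma powRrVK (r x : R) : r != 0 -> 0 <= x -> (x `^ r^-1) `^ r = x.
Proof. by move=> r0 x0; rewrite -powRrM mulVf// powRr1. Qed.

Lemma integral_mkcondb (b : pred R) (D : set R) (f : R -> \bar R) :
  (forall x, D x <-> b x) ->
  (\int[mu]_(x in D) f x = \int[mu]_x (if b x then f x else 0))%E.
Proof.
move=> Db; rewrite integral_mkcond; apply: eq_integral => x _; rewrite patchE.
by have -> : (x \in D) = b x by apply/idP/idP => [/set_mem/Db|/Db/mem_set].
Qed.

Lemma tonelliR (f : R * R -> \bar R) : measurable_fun [set: R * R] f ->
  (forall p, 0 <= f p)%E ->
  (\int[mu]_x \int[mu]_y f (x, y) = \int[mu]_y \int[mu]_x f (x, y))%E.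
Proof. by move=> mf f0; exact: (fubini_tonelli (m1 := mu) (m2 := mu) f mf f0). Qed.

(* Tonelli on the region [x < (t / D) ^ al]: both sides are the integral of [a x^(a-1) e^(-t)] over it. *)
Lemma integral_powR_expR_layer (a al D : R) : 0 < a -> 0 < al -> 0 < D ->
  (\int[mu]_(t in `]0%R, +oo[) (((t / D) `^ al) `^ a * expR (- t))%:E =
   \int[mu]_(x in `]0%R, +oo[) (a * x `^ (a - 1) * expR (- (x `^ al^-1 * D)))%:E)%E.
Proof.
move=> a0 al0 D0.
pose b (p : R * R) := [&& 0 < p.1, 0 < p.2 & p.2 `^ al^-1 * D < p.1].
pose f (p : R * R) : \bar R :=
  (if b p then a * p.2 `^ (a - 1) * expR (- p.1) else 0)%:E.
have f0 p : (0 <= f p)%E.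
  rewrite /f lee_fin; case: ifPn => // _.
  by rewrite !mulr_ge0 ?powR_ge0 ?expR_ge0 ?ltW.
have mpow (c : R) : measurable_fun [set: R * R] (fun p => p.2 `^ c).
  by apply: (@measurableT_comp _ _ _ _ _ _ (@powR R ^~ c)).
have mf : measurable_fun [set: R * R] f.
  apply/measurable_EFinP; apply: measurable_fun_ifT => //.
    apply: measurable_and; first exact: measurable_fun_ltr.
    apply: measurable_and; first exact: measurable_fun_ltr.
    by apply: measurable_fun_ltr => //; apply: measurable_funM.
  apply: measurable_funM; first exact: measurable_funM.
  by apply: measurableT_comp => //; exact: measurableT_comp.
rewrite (@integral_mkcondb (fun t => 0 < t)); last first.
  by move=> x; rewrite /= in_itv/= andbT.
rewrite [RHS](@integral_mkcondb (fun t => 0 < t)); last first.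
  by move=> x; rewrite /= in_itv/= andbT.
transitivity (\int[mu]_x \int[mu]_y f (x, y))%E.
  apply: eq_integral => t _; case: ifPn => t0; last first.
    by rewrite /f /b/= (negbTE t0)/= integral0.
  rewrite EFinM -integral_powR// ?powR_gt0 ?divr_gt0//.
  rewrite -ge0_integralZr//; last 2 first.
    apply/measurable_EFinP; apply: measurable_funTS.
    by apply: measurable_funM => //; exact: measurable_powR.
    by move=> x _; rewrite lee_fin mulr_ge0 ?powR_ge0 ?ltW.
  rewrite [LHS](@integral_mkcondb (fun x => 0 < x < (t / D) `^ al)); last first.
    by move=> x; rewrite /= in_itv.
  apply: eq_integral => x _; rewrite /f /b/= t0/=.
  have [x0|x0] //= := ltP 0 x.
  have -> : (x `^ al^-1 * D < t) = (x < (t / D) `^ al).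
    rewrite -ltr_pdivlMr// -[in RHS](@powRrVK al x) ?gt_eqF ?ltW//.
    by rewrite ltr_powR_mono ?powR_ge0 ?divr_ge0 ?ltW.
  by case: ifPn => // _; rewrite EFinM.
rewrite tonelliR//; apply: eq_integral => x _; case: ifPn => x0; last first.
  by rewrite integral0_eq// => t _; rewrite /f /b/= (negbTE x0)/= andbF.
rewrite EFinM -integral_expR_tail -[RHS]ge0_integralZl//; last 2 first.
  by apply/measurable_EFinP; apply: measurable_funTS; exact: measurableT_comp.
  by rewrite lee_fin mulr_ge0 ?powR_ge0 ?ltW.
rewrite [RHS](@integral_mkcondb (fun t => x `^ al^-1 * D < t)); last first.
  by move=> t; rewrite /= in_itv/= andbT.
apply: eq_integral => t _; rewrite /f /b/= x0/=.
rewrite andb_idl => [|]; last first.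
  by apply: le_lt_trans; rewrite mulr_ge0 ?powR_ge0 ?ltW.
by case: ifPn => // _; rewrite EFinM.
Qed.

(** [Gamma] is [fine] of this integral and would be 0 if it diverged; recurrence and finiteness are
    therefore established for the extended value first. *)
Let gE (a : R) : \bar R :=
  (\int[mu]_(s in `]0%R, +oo[) (s `^ (a - 1) * expR (- s))%:E)%E.

Lemma measurable_powR_expRN (D : set R) (a : R) :
  measurable_fun D (fun s : R => (s `^ a * expR (- s))%:E).
Proof.
apply: measurable_funTS; apply/measurable_EFinP; apply: measurable_funM.
  exact: measurable_powR.
by apply: measurableT_comp => //.
Qed.

Lemma powR_expRN_ge0 (a s : R) : (0 <= (s `^ a * expR (- s))%:E)%E.
Proof. by rewrite lee_fin mulr_ge0 ?powR_ge0 ?expR_ge0. Qed.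

(** The layer identity with [al] and [D] both equal to 1 plays the role of integration by parts,
    with no boundary terms to control. *)
Let gE_rec (a : R) : 0 < a -> gE (a + 1) = (a%:E * gE a)%E.
Proof.
move=> a0; have := @integral_powR_expR_layer a 1 1 a0 ltr01 ltr01.
rewrite /gE addrK => H; transitivity (\int[mu]_(t in `]0%R, +oo[) (((t / 1) `^ 1) `^ a * expR (- t))%:E)%E.
  apply: eq_integral => t; rewrite inE/= in_itv/= andbT => t0.
  by rewrite divr1 powRr1 ?ltW.
rewrite H -[RHS]ge0_integralZl//; last 3 first.
- exact: measurable_powR_expRN.
- by move=> x _; exact: powR_expRN_ge0.
- by rewrite lee_fin ltW.
apply: eq_integral => t; rewrite inE/= in_itv/= andbT => t0.
by rewrite invr1 powRr1 ?ltW// mulr1 -EFinM mulrA.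
Qed.

Let gE1 : gE 1 = 1%E.
Proof.
have := integral_expR_tail 0; rewrite oppr0 expR0 => <-.
by apply: eq_integral => t _; rewrite subrr powRr0 mul1r.
Qed.

Let gE_nat (n : nat) : gE (n%:R + 1) = (n`!%:R)%:E.
Proof.
elim: n => [|n ih]; first by rewrite add0r gE1.
by rewrite gE_rec// -natr1 ih -EFinM factS natrM natr1.
Qed.

(** The power s^(a - 1) is at most 1 up to [s = 1] and at most s^n beyond, and the integrals at
    integer arguments are factorials. *)
Let gE_ge1 (a : R) : 1 <= a -> (gE a < +oo)%E.
Proof.
move=> a1; set n := (Num.truncn a).+1.
have an : a - 1 <= n%:R.
  by rewrite (le_trans _ (ltW (truncnS_gt a)))// lerBlDr lerDl.
apply: (@le_lt_trans _ _ (gE 1 + gE (n%:R + 1))%E); last first.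
  by rewrite gE1 gE_nat -EFinD ltry.
rewrite /gE -ge0_integralD//; last 4 first.
- by move=> x _; exact: powR_expRN_ge0.
- exact: measurable_powR_expRN.
- by move=> x _; exact: powR_expRN_ge0.
- exact: measurable_powR_expRN.
apply: ge0_le_integral => //.
- by move=> x _; exact: powR_expRN_ge0.
- exact: measurable_powR_expRN.
- by apply: emeasurable_funD; exact: measurable_powR_expRN.
move=> s; rewrite /= in_itv/= andbT => s0.
rewrite -EFinD lee_fin -mulrDl ler_wpM2r ?expR_ge0//.
rewrite subrr powRr0 addrK; have [s1|s1] := leP s 1.
  rewrite ler_wpDr ?powR_ge0// -[leRHS](powRr0 s) ger_powR ?s0//.
  by rewrite subr_ge0.
by rewrite ler_wpDl// ler_powR// ltW.
Qed.

(** The recurrence carries finiteness from [a + 1] down to [a]: an infinite value times [a > 0]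
    would stay infinite. *)
Let gE_lty (a : R) : 0 < a -> (gE a < +oo)%E.
Proof.
move=> a0; have := @gE_ge1 (a + 1); rewrite lerDr => /(_ (ltW a0)).
by rewrite gE_rec//; case: (gE a) => [r|/=|]; rewrite ?ltry// gt0_muley.
Qed.

Lemma integral_Gamma (a : R) : 0 < a ->
  (\int[mu]_(s in `]0%R, +oo[) (s `^ (a - 1) * expR (- s))%:E = (Gamma a)%:E)%E.
Proof.
move=> a0; rewrite /Gamma /Rintegral fineK// ge0_fin_numE; last first.
  by apply: integral_ge0 => x _; exact: powR_expRN_ge0.
exact: gE_lty.
Qed.

Lemma GammaS (a : R) : 0 < a -> Gamma (a + 1) = a * Gamma a.
Proof.
move=> a0; apply: EFin_inj; rewrite EFinM -!integral_Gamma ?addr_gt0//.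
exact: gE_rec.
Qed.

Lemma Gamma_nat (n : nat) : Gamma (n%:R + 1 : R) = n`!%:R.
Proof.
apply: EFin_inj; rewrite -integral_Gamma ?ltr_wpDl//; exact: gE_nat.
Qed.

(** Only the part of the integral beyond [A] is kept, where s^a is at least A^a. The free parameter
    [A] later yields growth faster than any geometric sequence. *)
Lemma Gamma_ge (a A : R) : 0 <= a -> 0 < A -> A `^ a * expR (- A) <= Gamma (a + 1).
Proof.
move=> a0 A0; rewrite -lee_fin -integral_Gamma ?ltr_wpDl// addrK.
rewrite EFinM -integral_expR_tail -[leLHS]ge0_integralZl//; last 2 first.
- by apply/measurable_EFinP; apply: measurable_funTS; exact: measurableT_comp.
- by rewrite lee_fin powR_ge0.
apply: (@le_trans _ _ (\int[mu]_(x in `]A, +oo[) (x `^ a * expR (- x))%:E)%E).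
  apply: ge0_le_integral => //.
  - by move=> x _; rewrite mule_ge0// lee_fin ?powR_ge0 ?expR_ge0.
  - apply/measurable_EFinP; apply: measurable_funTS; apply: measurable_funM => //.
    by apply: measurableT_comp.
  - exact: measurable_powR_expRN.
  - move=> x; rewrite /= in_itv/= andbT => Ax.
    rewrite lee_fin ler_wpM2r ?expR_ge0// ge0_ler_powR// ?nnegrE ltW//.
    exact: lt_trans Ax.
apply: ge0_subset_integral => //.
- exact: measurable_powR_expRN.
- by move=> x _; exact: powR_expRN_ge0.
- by move=> x; rewrite /= !in_itv/= !andbT; exact: lt_trans.
Qed.

Lemma Gamma_gt0 (a : R) : 0 < a -> 0 < Gamma a.
Proof.
move=> a0; rewrite -(@pmulr_rgt0 _ a)// -GammaS//.
apply: lt_le_trans (@Gamma_ge a 1 (ltW a0) ltr01).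
by rewrite mulr_gt0 ?powR_gt0 ?expR_gt0.
Qed.

(** Writes a negative power of [D] as a mixture of exponentials exp(- s D), so that for random [D]
    its expectation can be read off the Laplace transform. *)
Lemma integral_powR_expR_powR (a al D : R) : 0 < a -> 0 < al -> 0 < D ->
  (\int[mu]_(x in `]0%R, +oo[) (a * x `^ (a - 1) * expR (- (x `^ al^-1 * D)))%:E
   = (Gamma (al * a + 1) * D `^ (- (al * a)))%:E)%E.
Proof.
move=> a0 al0 D0; rewrite -integral_powR_expR_layer// EFinM muleC.
have aa0 : 0 < al * a + 1 by rewrite addr_gt0 ?mulr_gt0.
rewrite -integral_Gamma// -ge0_integralZl//; last 3 first.
- exact: measurable_powR_expRN.
- by move=> x _; exact: powR_expRN_ge0.
- by rewrite lee_fin powR_ge0.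
apply: eq_integral => t; rewrite inE/= in_itv/= andbT => t0.
rewrite addrK -EFinM mulrA; congr (_ * _)%:E.
by rewrite -powRrM powRM ?invr_ge0 ?ltW// -powR_inv1 ?ltW// -powRrM mulN1r mulrC.
Qed.

(** The image of Lebesgue measure under x -> c x + b, multiplied by c, agrees with Lebesgue measure
    on half-open intervals, hence everywhere by uniqueness. *)
Lemma ge0_integral_affine (c b : R) (f : R -> \bar R) : 0 < c ->
  measurable_fun [set: R] f -> (forall x, 0 <= f x)%E ->
  (\int[mu]_x f x = c%:E * \int[mu]_x f (c * x + b)%R)%E.
Proof.
move=> c0 mf f0.
pose phi (x : measurableTypeR R) : measurableTypeR R := c * x + b.
have mphi : measurable_fun [set: measurableTypeR R] phi.
  by apply: measurable_funD => //; exact: measurable_funM.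
rewrite -[X in (_ * X)%E](@ge0_integral_pushforward _ _ _ _ _ phi mphi mu [set: _] f)//.
rewrite -[c%:E]/((NngNum (ltW c0))%:num%:E) -ge0_integral_mscale//.
apply: eq_measure_integral => A mA _.
apply: lebesgue_measure_unique mA => _ [[u v] _ <-] /=.
rewrite /mscale /= /pushforward.
have -> : phi @^-1` `]u, v] = `](u - b) / c, (v - b) / c]%classic.
  by apply/seteqP; split => x /=; rewrite !in_itv/= ltr_pdivrMr// ler_pdivlMr//
    ltrBlDr lerBrDr [x * c]mulrC.
rewrite !lebesgue_measure_itv/= !lte_fin ltr_pM2r ?invr_gt0// ltrD2r.
case: ifPn => _; last by rewrite mule0.
by rewrite -EFinB -!EFinB -EFinM; congr EFin; field; rewrite gt_eqF.
Qed.

Lemma measurable_fun_powR d (T : measurableType d) (D : set T) (f : T -> R) (p : R) :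
  measurable_fun D f -> measurable_fun D (fun x => f x `^ p).
Proof. by move=> mf; apply: (@measurableT_comp _ _ _ _ _ _ (@powR R ^~ p)). Qed.

Lemma ge0_EFin_integralZl (D : set R) (f : R -> \bar R) (k : R) :
  measurable (D : set (measurableTypeR R)) -> measurable_fun D f -> (forall x, 0 <= f x)%E ->
  0 <= k -> (k%:E * \int[mu]_(x in D) f x = \int[mu]_(x in D) (k%:E * f x))%E.
Proof. by move=> mD mf f0 k0; rewrite ge0_integralZl. Qed.

Let beta_kernel (a b v x : R) : R := x `^ (a - 1) * (v - x) `^ (b - 1).

Let measurable_beta_kernel (a b v : R) D : measurable_fun D (beta_kernel a b v).
Proof.
apply: measurable_funTS; apply: measurable_funM; first exact: measurable_powR.
by apply: measurable_fun_powR; exact: measurable_funB.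
Qed.

Let beta_kernel_ge0 (a b v x : R) : 0 <= beta_kernel a b v x.
Proof. by rewrite mulr_ge0 ?powR_ge0. Qed.

Let beta_scale (a b v : R) : 0 < v ->
  (\int[mu]_(x in `]0%R, v[) (beta_kernel a b v x)%:E =
   (v `^ (a + b - 1))%:E * \int[mu]_(x in `]0%R, 1%R[) (beta_kernel a b 1 x)%:E)%E.
Proof.
move=> v0.
rewrite (@integral_mkcondb (fun x => 0 < x < v)) => [|x]; last by rewrite /= in_itv.
have K0 b' (x : R) : (0 <= (if b' : bool then (beta_kernel a b v x)%:E else 0))%E.
  by case: b' => //; rewrite lee_fin.
rewrite (@ge0_integral_affine v 0)//; last first.
  apply: measurable_fun_ifT => //; last exact/measurable_EFinP.
  by apply: measurable_and; exact: measurable_fun_ltr.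
rewrite [in RHS](@integral_mkcondb (fun x => 0 < x < 1)) => [|x]; last by rewrite /= in_itv.
rewrite [LHS]ge0_EFin_integralZl; last 4 first.
- exact: measurableT.
- apply: measurable_fun_ifT => //; last first.
    apply/measurable_EFinP; apply: (@measurableT_comp _ _ _ _ _ _ (beta_kernel a b v)) => //.
    by apply: measurable_funD => //; exact: measurable_funM.
  apply: measurable_and; apply: measurable_fun_ltr => //.
    by apply: measurable_funD => //; exact: measurable_funM.
  by apply: measurable_funD => //; exact: measurable_funM.
- by move=> x; exact: K0.
- exact: ltW.
rewrite [RHS]ge0_EFin_integralZl; last 4 first.
- exact: measurableT.
- apply: measurable_fun_ifT => //; last exact/measurable_EFinP.
  by apply: measurable_and; exact: measurable_fun_ltr.
- by move=> x; case: ifPn => // _; rewrite lee_fin.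
- exact: powR_ge0.
apply: eq_integral => x _; rewrite addr0 pmulr_rgt0// gtr_pMr//.
case: ifPn => [/andP[x0 x1]|_]; last by rewrite !mule0.
rewrite -!EFinM /beta_kernel (_ : v - v * x = v * (1 - x)); last by ring.
rewrite !powRM ?subr_ge0 ?ltW//.
congr EFin; rewrite (_ : a + b - 1 = 1 + (a - 1) + (b - 1)); last by ring.
rewrite (gt0_powRD (1 + (a - 1)))// (gt0_powRD 1)// powRr1 ?ltW//; ring.
Qed.

(** The product of two Gamma integrals is a double integral over [0 < x < y], where y is the sum of
    the two integration variables. After Tonelli, homogeneity of the kernel pulls out y^(a + b - 1),
    which leaves the Gamma integral at [a + b]. *)
Let beta1 (a b : R) : 0 < a -> 0 < b ->
  ((Gamma a * Gamma b)%:E =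
   (Gamma (a + b))%:E * \int[mu]_(x in `]0%R, 1%R[) (beta_kernel a b 1 x)%:E)%E.
Proof.
move=> a0 b0.
pose g (p : R * R) := [&& 0 < p.1 & p.1 < p.2].
pose f (p : R * R) : \bar R :=
  (if g p then beta_kernel a b p.2 p.1 * expR (- p.2) else 0)%:E.
have f0 p : (0 <= f p)%E.
  by rewrite /f lee_fin; case: ifPn => // _; rewrite mulr_ge0 ?expR_ge0.
have mf : measurable_fun [set: R * R] f.
  apply/measurable_EFinP; apply: measurable_fun_ifT => //.
    by apply: measurable_and; exact: measurable_fun_ltr.
  apply: measurable_funM; last by apply: measurableT_comp => //; exact: measurableT_comp.
  apply: measurable_funM; first exact: measurable_fun_powR.
  by apply: measurable_fun_powR; exact: measurable_funB.
transitivity (\int[mu]_x \int[mu]_y f (x, y))%E.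
  rewrite EFinM -(integral_Gamma a0) -[LHS]ge0_integralZr//; last 3 first.
  - exact: measurable_powR_expRN.
  - by move=> x _; exact: powR_expRN_ge0.
  - by rewrite lee_fin ltW// Gamma_gt0.
  rewrite [LHS](@integral_mkcondb (fun x => 0 < x)) => [|x]; last by rewrite /= in_itv/= andbT.
  apply: eq_integral => x _; case: ifPn => x0; last first.
    by rewrite integral0_eq// => y _; rewrite /f /g/= (negbTE x0).
  rewrite -(integral_Gamma b0).
  rewrite [X in (_ * X)%E](@integral_mkcondb (fun x => 0 < x)) => [|y]; last by rewrite /= in_itv/= andbT.
  have mh : measurable_fun [set: R]
      (fun y : R => if 0 < y then (y `^ (b - 1) * expR (- y))%:E else 0%E).
    apply: measurable_fun_ifT => //; last exact: measurable_powR_expRN.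
    exact: measurable_fun_ltr.
  have h0 (y : R) : (0 <= if (0 < y)%R then (y `^ (b - 1) * expR (- y))%:E else 0%E)%E.
    by case: ifPn => // _; exact: powR_expRN_ge0.
  rewrite (@ge0_integral_affine 1 (- x))// mul1e -ge0_integralZl//; last 2 first.
  - have := measurableT_comp mh (_ : measurable_fun setT (fun y : R => 1 * y - x)).
    by apply; apply: measurable_funB => //; exact: measurable_funM.
  - by rewrite lee_fin mulr_ge0 ?powR_ge0 ?expR_ge0.
  apply: eq_integral => y _; rewrite mul1r subr_gt0 /f /g/= x0/=.
  case: ifPn => [xy|_]; last by rewrite mule0.
  rewrite -EFinM /beta_kernel; congr EFin.
  rewrite [LHS](_ : _ = x `^ (a - 1) * (y - x) `^ (b - 1) * (expR (- x) * expR (- (y - x)))); last by ring.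
  by rewrite -expRD; congr (_ * expR _); ring.
rewrite tonelliR//.
rewrite -integral_Gamma ?addr_gt0// -ge0_integralZr//; last 3 first.
- exact: measurable_powR_expRN.
- by move=> x _; exact: powR_expRN_ge0.
- by apply: integral_ge0 => x _; rewrite lee_fin.
rewrite [RHS](@integral_mkcondb (fun x => 0 < x)) => [|x]; last by rewrite /= in_itv/= andbT.
apply: eq_integral => v _; case: ifPn => v0; last first.
  rewrite integral0_eq// => x _; rewrite /f /g/=; case: ifPn => // /andP[x0 xv].
  by rewrite (lt_trans x0 xv) in v0.
rewrite EFinM muleAC -beta_scale// -ge0_integralZr//; last 2 first.
- by apply/measurable_EFinP; exact: measurable_beta_kernel.
- by move=> x _; rewrite lee_fin.
rewrite [RHS](@integral_mkcondb (fun x => 0 < x < v)) => [|x]; last by rewrite /= in_itv.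
by apply: eq_integral => x _; rewrite /f /g/=; case: ifPn.
Qed.

Lemma integral_beta (a b t : R) : 0 < a -> 0 < b -> 0 < t ->
  (\int[mu]_(x in `]0%R, t[) (x `^ (a - 1) * (t - x) `^ (b - 1))%:E =
   (t `^ (a + b - 1) * (Gamma a * Gamma b / Gamma (a + b)))%:E)%E.
Proof.
move=> a0 b0 t0; have G0 : 0 < Gamma (a + b) by rewrite Gamma_gt0 ?addr_gt0.
rewrite beta_scale// EFinM; congr (_ * _)%E.
by rewrite mulrC EFinM beta1// muleA -EFinM mulVf ?gt_eqF// mul1e.
Qed.

End gamma.

(** * Moment generating functions of counting and Skellam processes *)

Lemma cvgr_sum (R : realType) (U I : Type) (F : set_system U) (FF : Filter F) (s : seq I)
    (Q : pred I) (f : I -> U -> R) (l : I -> R) :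
  (forall i, Q i -> f i x @[x --> F] --> l i) ->
  (\sum_(i <- s | Q i) f i x) @[x --> F] --> \sum_(i <- s | Q i) l i.
Proof.
move=> fl; elim: s => [|i s ih].
  by under eq_fun do rewrite big_nil; rewrite big_nil; exact: cvg_cst.
under eq_fun do rewrite big_cons; rewrite big_cons.
by case: ifPn => // Qi; apply: cvgD => //; exact: fl.
Qed.

Lemma cvgn_minr (R : realType) (u : nat -> R) (l K : R) :
  u n @[n --> \oo] --> l -> Num.min (u n) K @[n --> \oo] --> Num.min l K.
Proof.
move=> ul; have cm : {for l, continuous (fun x : R => Num.min x K)}.
  by apply: continuous_min; [exact: cvg_id|exact: cvg_cst].
exact: (cvg_comp u (fun x : R => Num.min x K) ul cm).
Qed.

Section prob.
Context d (T : measurableType d) (R : realType) (P : probability T R).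

Lemma integral_prob_cst (c : R) : (\int[P]_w c%:E = c%:E)%E.
Proof. by have := expectation_cst P c; rewrite unlock. Qed.

(* The second-moment bound gives uniform integrability through [z <= min z K + z^2 / K]. *)
Lemma integral_lim_of_truncations (Z : T -> R) (Zn : nat -> T -> R) (a B : R) :
  measurable_fun [set: T] Z -> (forall w, 0 <= Z w) ->
  (forall n, measurable_fun [set: T] (Zn n)) -> (forall n w, 0 <= Zn n w) ->
  (forall K : nat, (\int[P]_w (Num.min (Zn n w) K%:R)%:E)%E @[n --> \oo] -->
     (\int[P]_w (Num.min (Z w) K%:R)%:E)%E) ->
  (\int[P]_w (Zn n w)%:E)%E @[n --> \oo] --> a%:E ->
  (forall n, \int[P]_w (Zn n w ^+ 2)%:E <= B%:E)%E ->
  (\int[P]_w (Z w)%:E = a%:E)%E.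
Proof.
move=> mZ Z0 mZn Zn0 trunc cvga leB.
have mmin (f : T -> R) (K : nat) : measurable_fun [set: T] f ->
    measurable_fun [set: T] (fun w => (Num.min (f w) K%:R : R)%:E).
  by move=> mf; apply/measurable_EFinP; exact: measurable_minr.
have min_ge0 (x : R) (K : nat) : 0 <= x -> 0 <= Num.min x K%:R.
  by move=> x0; rewrite le_min x0 ler0n.
have trunc_le K : (\int[P]_w (Num.min (Z w) K%:R)%:E <= a%:E)%E.
  apply: (lee_cvg_to (trunc K) cvga).
  apply: nearW => n; apply: ge0_le_integral => //.
  - by move=> w _; rewrite lee_fin min_ge0.
  - exact: mmin.
  - exact/measurable_EFinP.
  - by move=> w _; rewrite lee_fin ge_min lexx.
have trunc_leZ (K : nat) : (\int[P]_w (Num.min (Z w) K%:R)%:E <= \int[P]_w (Z w)%:E)%E.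
  apply: ge0_le_integral => //.
  - by move=> w _; rewrite lee_fin min_ge0.
  - exact: mmin.
  - exact/measurable_EFinP.
  - by move=> w _; rewrite lee_fin ge_min lexx.
apply/eqP; rewrite eq_le; apply/andP; split.
  have Zlim w : Num.min (Z w) K%:R @[K --> \oo] --> Z w.
    apply: cvg_near_cst; exists (Num.truncn (Z w)).+1 => // K /= ZK.
    apply/min_idPl; apply: (le_trans (ltW (truncnS_gt _))).
    by rewrite ler_nat.
  have -> : (\int[P]_w (Z w)%:E = \int[P]_w limn (fun K : nat => (Num.min (Z w) K%:R)%:E))%E.
    apply: eq_integral => w _; apply/esym/cvg_lim => //.
    by apply: cvg_EFin; [exact: nearW|exact: Zlim].
  rewrite monotone_convergence//; last 3 first.
  - by move=> K; exact: mmin.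
  - by move=> K w _; rewrite lee_fin min_ge0.
  - move=> w _ K L KL; rewrite lee_fin le_min ge_min lexx/= ge_min.
    by rewrite ler_nat KL orbT.
  apply: lime_le; last by apply: nearW => K; exact: trunc_le.
  apply: ereal_nondecreasing_is_cvgn => K L KL; apply: ge0_le_integral => //.
  - by move=> w _; rewrite lee_fin min_ge0.
  - exact: mmin.
  - exact: mmin.
  - by move=> w _; rewrite lee_fin le_min ge_min lexx/= ge_min ler_nat KL orbT.
have B0 : 0 <= B.
  rewrite -lee_fin; apply: le_trans (leB 0%N); apply: integral_ge0 => w _.
  by rewrite lee_fin sqr_ge0.
have low (K : nat) : (0 < K)%N -> (a%:E <= \int[P]_w (Z w)%:E + (B / K%:R)%:E)%E.
  move=> K0; have KR : 0 < K%:R :> R by rewrite ltr0n.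
  apply: (@le_trans _ _ (\int[P]_w (Num.min (Z w) K%:R)%:E + (B / K%:R)%:E)%E); last first.
    by rewrite leeD2r.
  apply: (lee_cvg_to cvga).
    by apply: cvgeD; [exact: fin_num_adde_defl|exact: trunc|exact: cvg_cst].
  apply: nearW => n.
  have -> : ((B / K%:R)%:E = K%:R^-1%:E * B%:E)%E by rewrite mulrC EFinM.
  apply: (@le_trans _ _ (\int[P]_w (Num.min (Zn n w) K%:R)%:E +
      K%:R^-1%:E * \int[P]_w (Zn n w ^+ 2)%:E)%E); last first.
    by rewrite leeD2l// lee_wpmul2l// lee_fin invr_ge0 ltW.
  have mZ2 : measurable_fun [set: T] (fun w => (Zn n w ^+ 2)%:E).
    by apply/measurable_EFinP; exact: measurable_funX.
  rewrite -ge0_integralZl//; last by move=> w _; rewrite lee_fin sqr_ge0.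
  rewrite -ge0_integralD//; last 4 first.
  - by move=> w _; rewrite lee_fin min_ge0.
  - exact: mmin.
  - by move=> w _; rewrite -EFinM lee_fin mulr_ge0 ?sqr_ge0 ?invr_ge0 ?ltW.
  - exact: measurable_funeM.
  apply: ge0_le_integral => //.
  - by move=> w _; rewrite lee_fin.
  - exact/measurable_EFinP.
  - by apply: emeasurable_funD; [exact: mmin|exact: measurable_funeM].
  move=> w _; rewrite -EFinM -EFinD lee_fin.
  have [le|lt] := leP (Zn n w) K%:R.
    by rewrite lerDl mulr_ge0 ?sqr_ge0 ?invr_ge0 ?ltW.
  apply: ler_wpDl; first exact: ltW.
  rewrite expr2 mulrA; apply: ler_peMl => //.
  by rewrite ler_pdivlMl// mulr1 ltW.
apply/lee_addgt0Pr => e e0.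
(* This [K] exceeds B / e, so the truncation error B / K is at most [e]. *)
have := low (Num.truncn (B / e)).+1 isT; move/le_trans; apply.
rewrite leeD2l// lee_fin ler_pdivrMr// mulrC -ler_pdivrMr//.
exact/ltW/truncnS_gt.
Qed.

(* The joint law is the product of the marginal laws; then Tonelli. *)
Lemma integral_prod_independent (X Y : T -> R) (f g : R -> R) :
  measurable_fun [set: T] X -> measurable_fun [set: T] Y ->
  (forall A B, measurable A -> measurable B ->
    P (X @^-1` A `&` Y @^-1` B) = (P (X @^-1` A) * P (Y @^-1` B))%E) ->
  measurable_fun [set: R] f -> measurable_fun [set: R] g ->
  (forall x, 0 <= f x) -> (forall x, 0 <= g x) ->
  (\int[P]_w (f (X w) * g (Y w))%:E =
   (\int[P]_w (f (X w))%:E) * (\int[P]_w (g (Y w))%:E))%E.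
Proof.
move=> mX mY ind mf mg f0 g0.
pose X' : {RV P >-> R} := mfun_Sub (mem_set mX).
pose Y' : {RV P >-> R} := mfun_Sub (mem_set mY).
pose m1 := distribution P X'. pose m2 := distribution P Y'.
pose XY (w : T) : R * R := (X w, Y w).
have mXY : measurable_fun [set: T] XY by exact: measurable_fun_pair.
pose h (p : R * R) : \bar R := (f p.1 * g p.2)%:E.
have mh : measurable_fun [set: R * R] h.
  apply/measurable_EFinP; apply: measurable_funM.
    by apply: (@measurableT_comp _ _ _ _ _ _ f).
  by apply: (@measurableT_comp _ _ _ _ _ _ g).
have h0 p : (0 <= h p)%E by rewrite lee_fin mulr_ge0.
have -> : (\int[P]_w (f (X w) * g (Y w))%:E = \int[pushforward P XY]_p h p)%E.
  by rewrite (ge0_integral_pushforward mXY).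
transitivity (\int[m1 \x m2]_p h p)%E.
  apply: eq_measure_integral => A mA _; apply/esym.
  exact: product_measure_unique mA.
rewrite fubini_tonelli1// /fubini_F.
have mfE : measurable_fun [set: R] (fun x => (f x)%:E) by exact/measurable_EFinP.
have mgE : measurable_fun [set: R] (fun x => (g x)%:E) by exact/measurable_EFinP.
have E1 : (\int[m1]_x (f x)%:E = \int[P]_w (f (X w))%:E)%E.
  by rewrite ge0_integral_distribution// => x; rewrite lee_fin.
have E2 : (\int[m2]_x (g x)%:E = \int[P]_w (g (Y w))%:E)%E.
  by rewrite ge0_integral_distribution// => x; rewrite lee_fin.
rewrite -E1 -E2 -ge0_integralZr//; last 2 first.
- by move=> x _; rewrite lee_fin.
- by apply: integral_ge0 => x _; rewrite lee_fin.
apply: eq_integral => x _.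
rewrite -ge0_integralZl//; last 2 first.
- by move=> y _; rewrite lee_fin.
- by rewrite lee_fin.
Qed.

Lemma indic_bigcap (A : nat -> set T) (n : nat) (w : T) :
  \1_(\bigcap_(i < n) A i) w = \prod_(i < n) \1_(A i) w :> R.
Proof.
elim: n => [|n ih]; first by rewrite bigcap_mkord !big_ord0 indicT.
by rewrite bigcap_mkord big_ord_recr/= indicI/= -bigcap_mkord ih big_ord_recr.
Qed.

(** Expanding the product of sums over choice functions leaves integrals of products of indicators,
    to which independence applies. The sets [Bs c] may overlap; in the application one of them is
    the whole line. *)
Lemma integral_prod_simple (n m : nat) (xi : nat -> T -> R) (v : 'I_m -> R)
    (Bs : 'I_m -> set R) :
  (forall i, measurable_fun [set: T] (xi i)) ->
  (forall c, measurable (Bs c)) ->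
  (forall B : nat -> set R, (forall i, measurable (B i)) ->
    P (\bigcap_(i < n) (xi i @^-1` B i)) = (\prod_(i < n) P (xi i @^-1` B i))%E) ->
  (\int[P]_w (\prod_(i < n) \sum_c v c * \1_(Bs c) (xi i w))%:E =
   (\prod_(i < n) \sum_c v c * fine (P (xi i @^-1` Bs c)))%:E)%E.
Proof.
move=> mxi mBs ind.
have mpre i (B : set R) : measurable B -> measurable (xi i @^-1` B).
  by move=> mB; rewrite -[X in measurable X]setTI; exact: mxi.
(* Indices beyond [n] receive the whole line, because [ind] expects a family of sets indexed by all
   of [nat]. *)
pose B (f : {ffun 'I_n -> 'I_m}) (i : nat) : set R :=
  if insub i is Some o then Bs (f o) else setT.
have mB f i : measurable (B f i) by rewrite /B; case: insub.
have BE f (i : 'I_n) : B f i = Bs (f i) by rewrite /B valK.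
pose A f := \bigcap_(i < n) (xi i @^-1` B f i).
have mA f : measurable (A f).
  by apply: bigcap_measurableType => i _; exact: mpre.
under eq_integral do rewrite bigA_distr_bigA/=.
have -> : (\int[P]_w (\sum_(f : {ffun 'I_n -> 'I_m})
      \prod_(i < n) (v (f i) * \1_(Bs (f i)) (xi i w)))%:E =
    \int[P]_w (\sum_(f : {ffun 'I_n -> 'I_m}) ((\prod_i v (f i))%:E * (\1_(A f) w)%:E)))%E.
  apply: eq_integral => w _; rewrite sumEFin; congr EFin.
  apply: eq_bigr => f _; rewrite big_split/=; congr (_ * _).
  rewrite indic_bigcap; apply: eq_bigr => i _; rewrite BE.
  by rewrite !indicE; congr (nat_of_bool _)%:R; apply/idP/idP; rewrite !inE.
rewrite integral_sum//; last first.
  by move=> f; apply: integrableZl => //; exact: integrable_indic.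
rewrite bigA_distr_bigA/= -sumEFin; apply: eq_bigr => f _.
rewrite integralZl//; last exact: integrable_indic.
have -> : (\int[P]_x (\1_(A f) x)%:E = \prod_(i < n) P (xi i @^-1` B f i))%E.
  by rewrite integral_indic// setIT; exact: ind.
rewrite big_split/= EFinM; congr (_ * _)%E.
rewrite -prodEFin; apply: eq_bigr => i _; rewrite BE fineK//.
by rewrite fin_num_measure//; exact: mpre.
Qed.

(** The truncated functions take values in [[0, K]] and differ only on [bad n], so their integrals
    differ by at most K times its probability. *)
Lemma integral_min_cvg_of_prob (Z : T -> R) (Zn : nat -> T -> R) (bad : nat -> set T) (K : nat) :
  measurable_fun [set: T] Z -> (forall w, 0 <= Z w) ->
  (forall n, measurable_fun [set: T] (Zn n)) -> (forall n w, 0 <= Zn n w) ->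
  (forall n, measurable (bad n)) ->
  (forall n w, ~ bad n w -> Zn n w = Z w) ->
  P (bad n) @[n --> \oo] --> 0%E ->
  (\int[P]_w (Num.min (Zn n w) K%:R)%:E)%E @[n --> \oo] -->
     (\int[P]_w (Num.min (Z w) K%:R)%:E)%E.
Proof.
move=> mZ Z0 mZn Zn0 mbad ZnE bad0.
have mmin (f : T -> R) : measurable_fun [set: T] f ->
    measurable_fun [set: T] (fun w => (Num.min (f w) K%:R : R)%:E).
  by move=> mf; apply/measurable_EFinP; exact: measurable_minr.
have min_ge0 (x : R) : 0 <= x -> 0 <= Num.min x K%:R.
  by move=> x0; rewrite le_min x0 ler0n.
have key (f g : T -> R) n : measurable_fun [set: T] f -> measurable_fun [set: T] g ->
    (forall w, 0 <= f w) -> (forall w, 0 <= g w) -> (forall w, ~ bad n w -> f w = g w) ->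
    (\int[P]_w (Num.min (f w) K%:R)%:E <=
     \int[P]_w (Num.min (g w) K%:R)%:E + K%:R%:E * P (bad n))%E.
  move=> mf mg f0 g0 fg.
  have -> : P (bad n) = (\int[P]_w (\1_(bad n) w)%:E)%E by rewrite integral_indic// setIT.
  have m1 : measurable_fun [set: T] (fun w => (\1_(bad n) w : R)%:E).
    by apply/measurable_EFinP; exact: measurable_indic.
  rewrite -ge0_integralZl//.
  rewrite -ge0_integralD//; last 3 first.
  - by move=> w _; rewrite lee_fin min_ge0.
  - exact: mmin.
  - exact: measurable_funeM.
  apply: ge0_le_integral => //.
  - by move=> w _; rewrite lee_fin min_ge0.
  - exact: mmin.
  - by apply: emeasurable_funD; [exact: mmin|exact: measurable_funeM].
  move=> w _; rewrite -EFinM -EFinD lee_fin indicE.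
  have [bw|/negP bw] := boolP (w \in bad n).
    by rewrite mulr1 ler_wpDl ?min_ge0// ge_min lexx orbT.
  rewrite fg; first by rewrite mulr0 addr0.
  by move=> bw'; apply: bw; rewrite inE.
have Zfin : (\int[P]_w (Num.min (Z w) K%:R)%:E)%E \is a fin_num.
  rewrite ge0_fin_numE; last by apply: integral_ge0 => w _; rewrite lee_fin min_ge0.
  apply: (@le_lt_trans _ _ (\int[P]_w (K%:R%:E))%E).
    apply: ge0_le_integral => //.
    - by move=> w _; rewrite lee_fin min_ge0.
    - exact: mmin.
    - by move=> w _; rewrite lee_fin ge_min lexx orbT.
  by rewrite integral_prob_cst ltry.
have KP0 : (K%:R%:E * P (bad n) @[n --> \oo] --> (0 : \bar R))%E.
  by rewrite -[X in _ --> X](mule0 (K%:R%:E)); apply: cvgeZl.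
apply: (@squeeze_cvge _ _ _ _
  (fun n => \int[P]_w (Num.min (Z w) K%:R)%:E - K%:R%:E * P (bad n))%E _
  (fun n => \int[P]_w (Num.min (Z w) K%:R)%:E + K%:R%:E * P (bad n))%E).
- apply: nearW => n; apply/andP; split; last by apply: key => // w /ZnE.
  rewrite leeBlDr; first by apply: key => // w /ZnE.
  by rewrite fin_numM// fin_num_measure.
- rewrite -[X in _ --> X]sube0; apply: cvgeB => //.
  + by rewrite fin_num_adde_defr// ?fin_numN.
  + exact: cvg_cst.
- rewrite -[X in _ --> X]adde0; apply: cvgeD => //.
  + by rewrite fin_num_adde_defr.
  + exact: cvg_cst.
Qed.

(** The power is squeezed between exp(n y / (1 + y)) and exp(n y), with n standing for the exponent.
    The upper bound is 1 + z <= exp z at z = y; the lower one is the same inequality at z = - y / (1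
    + y), inverted, which needs 1 + y > 0. *)
Lemma cvg_expR_exprn (y : nat -> R) (x : R) :
  (n.+1%:R * y n) @[n --> \oo] --> x ->
  ((1 + y n) ^+ n.+1) @[n --> \oo] --> expR x.
Proof.
move=> yx.
have y0 : y n @[n --> \oo] --> 0.
  have -> : y = (fun n => n.+1%:R^-1 * (n.+1%:R * y n)).
    by apply/funext => n; rewrite mulrA mulVf ?mul1r// pnatr_eq0.
  by rewrite -(mul0r x); apply: cvgM => //; exact: cvg_harmonic.
have cE (u : nat -> R) : u n @[n --> \oo] --> x -> expR (u n) @[n --> \oo] --> expR x.
  by move=> ux; apply: continuous_cvg => //; exact: continuous_expR.
apply: (@squeeze_cvgr _ _ _ _ (fun n => expR ((n.+1%:R * y n) / (1 + y n)))
   (fun n => expR (n.+1%:R * y n))).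
- have : \forall n \near \oo, `|y n| < 1.
    by have /cvgr0Pnorm_lt := y0; apply.
  apply: filterS => n; rewrite ltr_norml => /andP[yl yr].
  have p : 0 < 1 + y n by rewrite -ltrBlDl sub0r.
  rewrite expRM_natl -mulrA expRM_natl; apply/andP; split.
    apply: lerXn2r; [exact: expR_ge0|exact: ltW|].
    rewrite -[leRHS]invrK -[leLHS]invrK lef_pV2 ?posrE ?invr_gt0 ?expR_gt0// -expRN.
    apply: le_trans (expR_ge1Dx _).
    rewrite le_eqVlt; apply/orP; left; apply/eqP; field; lra.
  by apply: lerXn2r; [exact: ltW|exact: expR_ge0|exact: expR_ge1Dx].
- apply: cE; rewrite -[X in _ --> X]mulr1; apply: cvgM => //.
  rewrite -[X in _ --> X]invr1; apply: cvgV; first exact: oner_neq0.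
  by rewrite -[X in _ --> X]addr0; apply: cvgD => //; exact: cvg_cst.
- exact: cE.
Qed.

(** * Generalized counting processes: the moment generating function from the jump rates *)

Section gcp.
Variables (k : nat) (lam : nat -> R) (X : R -> T -> R).
Hypothesis gcpX : generalized_counting_process P k lam X.

Let levyX : levy_process P X. Proof. by case: gcpX. Qed.

(** Index 0 stands for the whole line with weight 1, not for the jump 0. The expectation of [G] is
    then 1 plus terms of order h, and values outside 0..k are sent to 1. *)
Let coef (u : R) (c : 'I_k.+1) : R := if c == ord0 then 1 else expR (u * c%:R) - 1.
Let evt (c : 'I_k.+1) : set R := if c == ord0 then setT else [set c%:R].
Let jumps : set R := \big[setU/set0]_(j < k.+1) [set j%:R].

(* [expR (u * x)] for a jump [x] in 0..k, and [1] elsewhere. *)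
Let G (u x : R) : R := \sum_c coef u c * \1_(evt c) x.

Let measurable_evt c : measurable (evt c).
Proof. by rewrite /evt; case: ifP. Qed.

Let measurable_jumps : measurable jumps.
Proof. by apply: bigsetU_measurable. Qed.

Let jumpsP x : jumps x <-> exists2 i : nat, (i <= k)%N & x = i%:R.
Proof.
rewrite /jumps -(bigcup_mkord k.+1 (fun j => [set j%:R : R])); split.
  by move=> [i /= ik ->]; exists i.
by move=> [i ik ->]; exists i.
Qed.

Let G_jump u x : jumps x -> G u x = expR (u * x).
Proof.
move=> /jumpsP[i ik ->]; rewrite /G (bigD1 ord0)//= {1}/coef {1}/evt eqxx indicT mul1r.
have [i0|i0] := eqVneq i 0%N.
  rewrite big1 => [|c c0]; first by rewrite i0 mulr0 expR0 addr0.
  rewrite /evt (negbTE c0) indicE memNset ?mulr0// i0/= => /eqP.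
  by rewrite eqr_nat eq_sym -(inj_eq val_inj)/= in c0 *; rewrite (negbTE c0).
have ik1 : (i < k.+1)%N by [].
rewrite (bigD1 (Ordinal ik1))//= big1 => [|c /andP[c0 ci]]; last first.
  rewrite /evt (negbTE c0) indicE memNset ?mulr0//= => /eqP.
  by rewrite eqr_nat eq_sym => /eqP ici; move: ci; rewrite -(inj_eq val_inj)/= ici eqxx.
rewrite /coef /evt -!(inj_eq val_inj)/= (negbTE i0) indicE mem_set// mulr1 addr0.
by rewrite addrC subrK.
Qed.

Let G_Njump u x : ~ jumps x -> G u x = 1.
Proof.
move=> Jx; rewrite /G (bigD1 ord0)//= {1}/coef {1}/evt eqxx indicT mul1r.
rewrite big1 ?addr0// => c c0; rewrite /evt (negbTE c0) indicE memNset ?mulr0//= => xc.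
by apply: Jx; apply/jumpsP; exists c => //; rewrite -ltnS.
Qed.

Let G_ge0 u x : 0 <= G u x.
Proof.
by have [/G_jump ->|/G_Njump ->] := pselect (jumps x); rewrite ?expR_ge0.
Qed.

(** Squaring doubles [u], so the second moments needed for uniform integrability are first moments
    of the same form. *)
Let G_sqr u x : G u x ^+ 2 = G (2 * u) x.
Proof.
have [Jx|Jx] := pselect (jumps x); last by rewrite !G_Njump// expr1n.
by rewrite !G_jump// -expRM_natl mulrA.
Qed.

Let measurable_G u : measurable_fun [set: R] (G u).
Proof.
by apply: measurable_sum => c; exact: measurable_funM.
Qed.

Let y (u h : R) : R :=
  \sum_(1 <= j < k.+1) (expR (u * j%:R) - 1) * fine (P [set w | X h w = j%:R]).

Let measurable_X (t : R) : 0 <= t -> measurable_fun [set: T] (X t).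
Proof. by move=> t0; exact: (levy_measurable levyX). Qed.

Let measurable_pre (t : R) (B : set R) : 0 <= t -> measurable B -> measurable (X t @^-1` B).
Proof.
by move=> t0 mB; rewrite -[X in measurable X]setTI; exact: measurable_X.
Qed.

Let sum_coef u h : 0 <= h -> \sum_c coef u c * fine (P (X h @^-1` evt c)) = 1 + y u h.
Proof.
move=> h0; rewrite big_ord_recl /coef /evt/= preimage_setT probability_setT mul1r; congr (_ + _).
rewrite /y big_add1 big_mkord; apply: eq_bigr => c _.
by rewrite /= /bump/= add1n.
Qed.

Let q (h : R) : R := 1 - \sum_(j < k.+1) fine (P [set w | X h w = j%:R]).

Let P_Njumps h : 0 <= h -> P (X h @^-1` ~` jumps) = (q h)%:E.
Proof.
move=> h0.
have JE : X h @^-1` jumps = \big[setU/set0]_(j < k.+1) [set w | X h w = j%:R].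
  rewrite /jumps; elim/big_ind2 : _ => [|A B C D <- <-|//]; first by rewrite preimage_set0.
  by rewrite preimage_setU.
have mj (j : nat) : measurable [set w | X h w = j%:R] by exact: (@measurable_pre h [set j%:R]).
have -> : X h @^-1` (~` jumps) = ~` \big[setU/set0]_(j < k.+1) [set w | X h w = j%:R].
  by rewrite -JE.
rewrite probability_setC; last exact: bigsetU_measurable.
rewrite /q EFinB; congr (_ - _)%E.
rewrite measure_semi_additive_ord//=; last 2 first.
- move=> i j _ _ [w [/= -> /eqP]]; rewrite eqr_nat => /eqP ij.
  exact: val_inj.
- by apply: bigsetU_measurable.
by rewrite -sumEFin; apply: eq_bigr => j _; rewrite fineK// fin_num_measure.
Qed.

Section fixed_time.
Variables (t : R) (t0 : 0 < t).

Let h (n : nat) : R := t / n.+1%:R.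
Let tt (n i : nat) : R := i%:R * h n.
Let xi (n i : nat) : T -> R := increment X (tt n i) (tt n i.+1).
Let W (u : R) (n : nat) (w : T) : R := \prod_(i < n.+1) G u (xi n i w).

Let h_gt0 n : 0 < h n. Proof. by rewrite divr_gt0. Qed.

Let tt_ge0 n i : 0 <= tt n i. Proof. by rewrite mulr_ge0// ltW. Qed.

Let ttS n i : tt n i.+1 = tt n i + h n.
Proof. by rewrite /tt -natr1 mulrDl mul1r. Qed.

Let measurable_xi n i : measurable_fun [set: T] (xi n i).
Proof. by apply: measurable_funB; exact: measurable_X. Qed.

Let P_xi n i (B : set R) : measurable B -> P (xi n i @^-1` B) = P (X (h n) @^-1` B).
Proof.
by move=> mB; rewrite /xi ttS; apply: (levy_stationary levyX) => //; exact: ltW.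
Qed.

Let h_cvg0 : h n @[n --> \oo] --> 0.
Proof.
rewrite -(mulr0 t); apply: cvgM; first exact: cvg_cst.
exact: cvg_harmonic.
Qed.

Let rate_cvg (f : R -> R) (l : R) : f x / x @[x --> 0^'+] --> l ->
  n.+1%:R * f (h n) @[n --> \oo] --> t * l.
Proof.
move=> /cvg_at_rightP/(_ h (conj h_gt0 h_cvg0)) fl.
rewrite (_ : (fun n => _) = (fun n => t * (f (h n) / h n))).
  by apply: cvgM fl; exact: cvg_cst.
apply/funext => n; rewrite /h invf_div; field.
by rewrite gt_eqF.
Qed.

Let S (u : R) : R := \sum_(1 <= j < k.+1) lam j * (expR (u * j%:R) - 1).

Let y_cvg u : n.+1%:R * y u (h n) @[n --> \oo] --> t * S u.
Proof.
apply: rate_cvg; rewrite /S.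
under eq_fun do rewrite /y mulr_suml big_add1 big_mkord.
rewrite big_add1 big_mkord; apply: cvgr_sum => j _.
under eq_fun do rewrite -mulrA mulrC.
have [_ /(_ j.+1) + _] := gcpX; rewrite /= ltn_ord => /(_ isT) pj.
by apply: cvgM; [|exact: cvg_cst].
Qed.

(** The rate of leaving 0 equals the sum of the rates of the jumps 1..k, so no rate is left for any
    other value. *)
Let q_cvg : n.+1%:R * q (h n) @[n --> \oo] --> 0.
Proof.
rewrite -(mulr0 t); apply: rate_cvg.
rewrite -[X in _ --> X](subrr (\sum_(1 <= j < k.+1) lam j)).
rewrite (_ : (fun x => _) = (fun x => (1 - fine (P [set w | X x w = 0])) / x -
    \sum_(1 <= j < k.+1) fine (P [set w | X x w = j%:R]) / x)); last first.
  apply/funext => x; rewrite /q big_ord_recl big_add1 big_mkord -mulr_suml -mulrBl.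
  by rewrite opprD addrA; congr ((_ - _) / _); apply: eq_bigr => j _; rewrite /bump add1n.
have [_ pj p0] := gcpX; apply: cvgB => //.
under eq_fun do rewrite big_add1 big_mkord.
rewrite big_add1 big_mkord; apply: cvgr_sum => j _.
by apply: pj; rewrite /= ltn_ord.
Qed.

Let integral_W u n : (\int[P]_w (W u n w)%:E = ((1 + y u (h n)) ^+ n.+1)%:E)%E.
Proof.
rewrite /W /G integral_prod_simple//.
- rewrite (eq_bigr (fun=> 1 + y u (h n))); first by rewrite prodr_const card_ord.
  move=> i _; rewrite -sum_coef ?ltW//; apply: eq_bigr => c _.
  by rewrite P_xi.
- move=> B mB; apply: (levy_independent levyX) => //.
  by move=> i j ij; rewrite ler_wpM2r ?ler_nat// ltW.
Qed.

Let bad0 : exists2 N, measurable N /\ P N = 0%E & forall w, ~ N w -> X 0 w = 0.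
Proof.
have [N [mN PN0 NX]] := levy_start levyX.
by exists N => // w Nw; apply: contrapT => Xw; apply: Nw; exact: NX.
Qed.

Lemma gcp_mgf_pos u : (\int[P]_w (expR (u * X t w))%:E = (expR (t * S u))%:E)%E.
Proof.
have [N [mN PN0] X00] := bad0.
have mW v n : measurable_fun [set: T] (W v n).
  apply: measurable_prod => i _.
  exact: (measurableT_comp (measurable_G v)).
have W0 v n w : 0 <= W v n w by apply: prodr_ge0 => i _; exact: G_ge0.
(* Outside [bad n] the path starts at 0 and every grid increment is an admissible jump, so [W u n]
   telescopes to exp(u X t). By stationarity and the union bound, [bad n] has probability at most
   [n.+1%:R * q (h n)]. *)
pose bad n := N `|` \bigcup_(i < n.+1) (xi n i @^-1` ~` jumps).
have mbad n : measurable (bad n).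
  apply: measurableU => //; apply: bigcup_measurable => i _.
  by rewrite -[X in measurable X]setTI; apply: measurable_xi => //; exact: measurableC.
have W_cvg v : (1 + y v (h n)) ^+ n.+1 @[n --> \oo] --> expR (t * S v).
  exact: cvg_expR_exprn.
(* The second moment of [W u n] is the mean of [W (2 * u) n]; these means converge, hence are
   bounded. *)
have [B Bub] : exists B, forall n, (1 + y (2 * u) (h n)) ^+ n.+1 <= B.
  have /cvg_seq_bounded/= [B [_ /(_ (B + 1))]] : cvgn (fun n => (1 + y (2 * u) (h n)) ^+ n.+1).
    by apply/cvg_ex; eexists; exact: W_cvg.
  rewrite ltrDl ltr01 => /(_ isT) H; exists (B + 1) => n.
  by apply: le_trans (ler_norm _) (H n _).
apply: (@integral_lim_of_truncations _ (W u) _ B) => //.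
- apply: measurableT_comp => //; apply: measurable_funM => //.
  by apply: measurable_X; exact: ltW.
- move=> K; apply: (@integral_min_cvg_of_prob _ _ bad) => //.
  + apply: measurableT_comp => //; apply: measurable_funM => //.
    by apply: measurable_X; exact: ltW.
  + move=> n w badw.
    have X0w : X 0 w = 0 by apply: X00 => Nw; apply: badw; left.
    have Jw i : (i < n.+1)%N -> jumps (xi n i w).
      by move=> i_n; apply: contrapT => Jiw; apply: badw; right; exists i.
    rewrite /W (eq_bigr (fun i : 'I_n.+1 => expR (u * xi n i w))); last first.
      by move=> i _; rewrite G_jump//; exact: Jw.
    rewrite -expR_sum -mulr_sumr; congr (expR (_ * _)).
    rewrite -(big_mkord xpredT (fun i => xi n i w)) /xi /increment.
    rewrite telescope_sumr// [in X in _ - X]/tt mul0r X0w subr0.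
    by congr (X _ w); rewrite /tt /h mulrC divfK// pnatr_eq0.
  + apply: (@squeeze_cvge _ _ _ _ (fun=> 0%E) _ (fun n => (n.+1%:R * q (h n))%:E)) => //.
    * apply: nearW => n; rewrite measure_ge0/=.
      apply: le_trans (measureU2 _ _ _) _ => //.
        apply: bigcup_measurable => i _.
        by rewrite -[X in measurable X]setTI; apply: measurable_xi => //; exact: measurableC.
      rewrite [X in (X + _)%E](_ : _ = 0%E); last exact: PN0.
      rewrite add0e bigcup_mkord.
      apply: (@le_trans _ _ (\sum_(i < n.+1) P (xi n i @^-1` ~` jumps))%E).
        apply: (@Boole_inequality _ _ _ P (fun i => xi n i @^-1` ~` jumps)) => i _.
        by rewrite -[X in measurable X]setTI; apply: measurable_xi => //; exact: measurableC.
      rewrite (eq_bigr (fun=> (q (h n))%:E)); last first.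
        by move=> i _; rewrite P_xi ?P_Njumps ?ltW//; exact: measurableC.
      by rewrite sumEFin sumr_const card_ord mulr_natl.
    * exact: cvg_cst.
    * by apply: cvg_EFin; [exact: nearW|exact: q_cvg].
- under eq_fun do rewrite integral_W.
  by apply: cvg_EFin; [exact: nearW|exact: W_cvg].
- move=> n; rewrite (eq_integral (fun w => (W (2 * u) n w)%:E)).
    by rewrite integral_W lee_fin.
  move=> w _; congr EFin; rewrite /W -prodrXl; apply: eq_bigr => i _; exact: G_sqr.
Qed.

End fixed_time.

Lemma gcp_mgf (u t : R) : 0 <= t ->
  (\int[P]_w (expR (u * X t w))%:E =
   (expR (t * \sum_(1 <= j < k.+1) lam j * (expR (u * j%:R) - 1)))%:E)%E.
Proof.
rewrite le_eqVlt => /predU1P[<-|]; last by move=> t0; exact: gcp_mgf_pos.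
rewrite mul0r expR0 -(integral_prob_cst 1); apply: ge0_ae_eq_integral => //.
- apply/measurable_EFinP; apply: measurableT_comp => //; apply: measurable_funM => //.
  exact: measurable_X.
- have := levy_start levyX; apply: filterS => w X0 _.
  by rewrite X0 mulr0 expR0.
Qed.

End gcp.

Lemma process_sigma_algebra_preimage (X : R -> T -> R) (t : R) (A : set R) :
  0 <= t -> measurable A -> process_sigma_algebra X (X t @^-1` A).
Proof.
move=> t0 mA; apply: sub_sigma_algebra; exists t => //.
by exists A => //; rewrite setTI.
Qed.

Section skellam.
Variables (k : nat) (lam mu : nat -> R) (S : R -> T -> R).
Hypothesis gspS : generalized_skellam_process P k lam mu S.

Lemma skellam_measurable (t : R) : 0 <= t -> measurable_fun [set: T] (S t).
Proof.
have [M1 [M2 [[L1 _ _] [L2 _ _] _ SE]]] := gspS; move=> t0.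
have -> : S t = M1 t \- M2 t by apply/funext => w; rewrite SE.
by apply: measurable_funB; [exact: (levy_measurable L1)|exact: (levy_measurable L2)].
Qed.

Lemma skellam_right_continuous w (t : R) : 0 <= t -> S s w @[s --> t^'+] --> S t w.
Proof.
have [M1 [M2 [[L1 _ _] [L2 _ _] _ SE]]] := gspS; move=> t0.
rewrite SE//.
apply: (@cvg_trans _ ((M1 s w - M2 s w) @[s --> t^'+])).
  apply: near_eq_cvg; near=> s; rewrite SE//; apply: le_trans t0 _.
  by near: s; exact: nbhs_right_ge.
apply: cvgB; first by apply: (levy_cadlag L1 w).1.
by apply: (levy_cadlag L2 w).1.
Unshelve. all: by end_near. Qed.

Lemma skellam_mgf (u t : R) : 0 <= t ->
  (\int[P]_w (expR (u * S t w))%:E = (expR (t * skellam_exponent k lam mu u))%:E)%E.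
Proof.
have [M1 [M2 [G1 G2 ind SE]]] := gspS; move=> t0.
have [[L1 _ _] [L2 _ _]] := (G1, G2).
have mexp (v : R) : measurable_fun [set: R] (fun x => expR (v * x)).
  by apply: measurableT_comp => //; exact: measurable_funM.
rewrite (eq_integral (fun w => (expR (u * M1 t w) * expR (- u * M2 t w))%:E)); last first.
  by move=> w _; rewrite SE// mulrBr -mulNr expRD.
rewrite (@integral_prod_independent (M1 t) (M2 t) (fun x => expR (u * x))
  (fun x => expR (- u * x)))//.
- rewrite (gcp_mgf G1)// (gcp_mgf G2)// -EFinM -expRD -mulrDr -big_split.
  congr (expR (_ * _))%:E; apply: eq_bigr => j _.
  by rewrite mulNr.
- exact: (levy_measurable L1).
- exact: (levy_measurable L2).
- by move=> A B mA mB; apply: ind; exact: process_sigma_algebra_preimage.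
Qed.

End skellam.

Lemma integral_partition (E : nat -> set T) (N : T -> nat) (g : nat -> T -> R) :
  (forall m, measurable (E m)) -> (forall m, measurable_fun [set: T] (g m)) ->
  (forall m w, E m w <-> N w = m) -> (forall m w, 0 <= g m w) ->
  (\int[P]_w (g (N w) w)%:E =
   \sum_(0 <= m <oo) \int[P]_w (\1_(E m) w * g m w)%:E)%E.
Proof.
move=> mE mg EN g0.
rewrite -integral_nneseries; last 3 first.
- exact: measurableT.
- move=> m; apply/measurable_EFinP; apply: measurable_funM; last exact: mg.
  exact: measurable_indic.
- by move=> m w _; rewrite lee_fin mulr_ge0.
apply: eq_integral => w _; apply/esym/cvg_lim => //; apply: cvg_near_cst.
exists (N w).+1 => // n /= Nn.
rewrite sumEFin; congr EFin; rewrite (bigD1_seq (N w))/= ?iota_uniq ?mem_index_iota//.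
rewrite indicE mem_set ?mul1r; last exact/EN.
rewrite big1 ?addr0// => m mN; rewrite indicE memNset ?mul0r// => /EN Nm.
by rewrite Nm eqxx in mN.
Qed.

(** * The Skellam process at an independent random time *)

Section time_change.
Variables (k : nat) (lam mu : nat -> R) (S : R -> T -> R) (tau : T -> R).
Hypothesis gspS : generalized_skellam_process P k lam mu S.
Hypothesis mtau : measurable_fun [set: T] tau.
Hypothesis tau_ge0 : forall w, 0 <= tau w.
Hypothesis indep : forall (s : R) A B, 0 <= s -> measurable A -> measurable B ->
  P (S s @^-1` A `&` tau @^-1` B) = (P (S s @^-1` A) * P (tau @^-1` B))%E.
Hypothesis tau_exp : forall c : R, (\int[P]_w (expR (c * tau w))%:E < +oo)%E.

(* [tau] rounded up to the grid of mesh [1 / n.+1], always strictly. *)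
Let N (n : nat) (w : T) : nat := Num.truncn (n.+1%:R * tau w).
Let s (n m : nat) : R := m.+1%:R / n.+1%:R.
Let tauN (n : nat) (w : T) : R := s n (N n w).
Let I (n m : nat) : set R := [set x : R | m%:R <= n.+1%:R * x < m.+1%:R].
Let E (n m : nat) : set T := tau @^-1` I n m.

Let measurable_I n m : measurable (I n m).
Proof.
have -> : I n m = `[m%:R / n.+1%:R, m.+1%:R / n.+1%:R[%classic.
  apply/seteqP; split => x; rewrite /I /= in_itv/= ler_pdivrMr// ltr_pdivlMr//;
  by rewrite [x * _]mulrC.
exact: measurable_itv.
Qed.

Let measurable_E n m : measurable (E n m).
Proof. by rewrite -[X in measurable X]setTI; exact: mtau. Qed.

Let EN n m w : E n m w <-> N n w = m.
Proof.
rewrite /E /I /N /=; split.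
  by move=> /andP[h1 h2]; apply: truncn_def; rewrite h1.
by move=> <-; rewrite truncn_le ?truncnS_gt// mulr_ge0.
Qed.

Let s_ge0 n m : 0 <= s n m. Proof. by rewrite divr_ge0. Qed.

Let tau_lt n w : tau w < tauN n w.
Proof. by rewrite /tauN /s ltr_pdivlMr// mulrC truncnS_gt. Qed.

Let tauN_le n w : tauN n w <= tau w + n.+1%:R^-1.
Proof.
rewrite /tauN /s ler_pdivrMr// mulrDl mulVf ?pnatr_eq0// -natr1 lerD2r mulrC.
by rewrite truncn_le// mulr_ge0.
Qed.

Let tauN_cvg w : tauN n w @[n --> \oo] --> tau w.
Proof.
apply: (@squeeze_cvgr _ _ _ _ (fun=> tau w) (fun n => tau w + n.+1%:R^-1)).
- by apply: nearW => n; rewrite tauN_le ltW.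
- exact: cvg_cst.
- rewrite -[X in _ --> X]addr0; apply: cvgD; first exact: cvg_cst.
  exact: cvg_harmonic.
Qed.

Let U (n : nat) (w : T) : R := S (tauN n w) w.
Let V (w : T) : R := S (tau w) w.

(** The paths are only right-continuous and the right limit ignores the point itself, hence the
    strict approach of [tau] from above. *)
Let U_cvg w : U n w @[n --> \oo] --> V w.
Proof.
have /cvg_at_rightP := skellam_right_continuous gspS (w := w) (tau_ge0 w).
by apply; split => // n; exact: tau_lt.
Qed.

(** Only countably many times occur in [U n], so measurability of each [S t] suffices and no joint
    measurability in time is involved. *)
Let measurable_U n : measurable_fun [set: T] (U n).
Proof.
move=> _ A mA; rewrite setTI.
have -> : U n @^-1` A = \bigcup_m (E n m `&` S (s n m) @^-1` A).
  apply/seteqP; split => w /=.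
    by move=> Aw; exists (N n w) => //; split => //; exact/EN.
  by move=> [m _ [/EN Nm Aw]]; rewrite /U /tauN Nm.
apply: bigcupT_measurable => m; apply: measurableI => //.
by rewrite -[X in measurable X]setTI; apply: (skellam_measurable gspS).
Qed.

Lemma time_change_measurable : measurable_fun [set: T] V.
Proof. by apply: measurable_fun_cvg measurable_U _ => w _; exact: U_cvg. Qed.

Let psi (u : R) := skellam_exponent k lam mu u.

(** On each grid cell the rounded time is deterministic and the cell is an event of [tau], so
    independence splits the integral and [skellam_mgf] evaluates one factor. *)
Let integral_U u n :
  (\int[P]_w (expR (u * U n w))%:E = \int[P]_w (expR (psi u * tauN n w))%:E)%E.
Proof.
have mS m : measurable_fun [set: T] (S (s n m)) by exact: (skellam_measurable gspS).
have mexp (v : R) : measurable_fun [set: R] (fun x => expR (v * x)).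
  by apply: measurableT_comp => //; exact: measurable_funM.
rewrite (@integral_partition (E n) (N n) (fun m w => expR (u * S (s n m) w)))//; last first.
  by move=> m; exact: (measurableT_comp (mexp u)).
transitivity (\sum_(0 <= m <oo) \int[P]_w (\1_(E n m) w * expR (psi u * s n m))%:E)%E; last first.
  apply/esym; apply: (@integral_partition (E n) (N n) (fun m w => expR (psi u * s n m))).
  - exact: measurable_E.
  - by move=> m; exact: measurable_cst.
  - exact: EN.
  - by move=> m w; exact: expR_ge0.
apply: eq_eseriesr => m _.
have -> : (\int[P]_w (\1_(E n m) w * expR (u * S (s n m) w))%:E =
    \int[P]_w (expR (u * S (s n m) w) * \1_(I n m) (tau w))%:E)%E.
  by apply: eq_integral => w _; rewrite mulrC.
rewrite (@integral_prod_independent (S (s n m)) tau (fun x => expR (u * x)) (\1_(I n m)))//; last first.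
  by move=> A B mA mB; exact: indep.
rewrite (skellam_mgf gspS)// mulrC -/(psi u) -ge0_integralZl//; last first.
  apply/measurable_EFinP; apply: (measurableT_comp (measurable_indic _) mtau).
  exact: measurable_I.
by apply: eq_integral => w _; rewrite -EFinM [in RHS]mulrC; congr (_ * _)%:E.
Qed.

Let mexp_tau (f : T -> R) (c : R) : measurable_fun [set: T] f ->
  measurable_fun [set: T] (fun w => (expR (c * f w))%:E).
Proof.
by move=> mf; apply/measurable_EFinP; apply: measurableT_comp => //; exact: measurable_funM.
Qed.

Let measurable_tauN n : measurable_fun [set: T] (tauN n).
Proof.
move=> _ A mA; rewrite setTI.
have -> : tauN n @^-1` A = \bigcup_(m in [set m | A (s n m)]) E n m.
  apply/seteqP; split => w /=; first by move=> Aw; exists (N n w) => //; exact/EN.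
  by move=> [m /= Am /EN Nm]; rewrite /tauN Nm.
by apply: bigcup_measurable.
Qed.

Let tauN_exp_le (c : R) n w : expR (c * tauN n w) <= expR `|c| * expR (`|c| * tau w).
Proof.
rewrite -expRD ler_expR (_ : `|c| + `|c| * tau w = `|c| * (1 + tau w)); last by rewrite mulrDr mulr1.
apply: le_trans (ler_norm _) _; rewrite normrM ler_wpM2l//.
rewrite ger0_norm; last exact: s_ge0.
by apply: le_trans (tauN_le n w) _; rewrite addrC lerD2r invf_le1// ler1n.
Qed.

Let tau_dom (c : R) :
  P.-integrable [set: T] (fun w => (expR `|c| * expR (`|c| * tau w))%:E).
Proof.
apply: (@eq_integrable _ _ _ _ _ _ (fun w => ((expR `|c|)%:E * (expR (`|c| * tau w))%:E)%E)) => //.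
apply: integrableZl => //; apply/integrableP; split; first exact: mexp_tau.
rewrite (eq_integral (fun w => (expR (`|c| * tau w))%:E)); first exact: tau_exp.
by move=> w _; rewrite gee0_abs// lee_fin expR_ge0.
Qed.

(** Path convergence handles the truncated exponentials, but the exponentials of [U n] themselves
    have no evident dominating function. Their second moments, which are first moments at [2 * u],
    are bounded through [integral_U]. *)
Lemma time_change_mgf (u : R) :
  (\int[P]_w (expR (u * S (tau w) w))%:E =
   \int[P]_w (expR (skellam_exponent k lam mu u * tau w))%:E)%E.
Proof.
have fin c : (\int[P]_w (expR (c * tau w))%:E)%E \is a fin_num.
  by rewrite ge0_fin_numE//; apply: integral_ge0 => w _; rewrite lee_fin expR_ge0.
rewrite -/(psi u) -[RHS]fineK//.
have tauN_int c : (\int[P]_w (expR (c * tauN n w))%:E)%E @[n --> \oo] -->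
    (\int[P]_w (expR (c * tau w))%:E)%E.
  apply: (@dominated_cvg _ _ _ P setT _ _ _ (fun w => (expR `|c| * expR (`|c| * tau w))%:E)) => //.
  - by move=> n; exact: mexp_tau.
  - move=> w _; apply: cvg_EFin; first exact: nearW.
    apply: continuous_cvg; first exact: continuous_expR.
    by apply: cvgM; [exact: cvg_cst|exact: tauN_cvg].
  - by move=> n w _; rewrite lee_fin ger0_norm ?expR_ge0.
apply: (@integral_lim_of_truncations _ (fun n w => expR (u * U n w)) _
  (fine (\int[P]_w (expR `|psi (2 * u)| * expR (`|psi (2 * u)| * tau w))%:E)%E)) => //.
- by have := mexp_tau u time_change_measurable; move/measurable_EFinP.
- by move=> n; have := mexp_tau u (measurable_U n); move/measurable_EFinP.
- move=> K; apply: (@dominated_cvg _ _ _ P setT _ _ _ (fun=> (K%:R)%:E)) => //.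
  + move=> n; apply/measurable_EFinP; apply: measurable_minr => //.
    by have := mexp_tau u (measurable_U n); move/measurable_EFinP.
  + move=> w _; apply: cvg_EFin; first exact: nearW.
    apply: (@cvgn_minr R (fun n => expR (u * U n w))).
    apply: continuous_cvg; first exact: continuous_expR.
    by apply: cvgM; [exact: cvg_cst|exact: U_cvg].
  + exact: (finite_measure_integrable_cst P K%:R measurableT).
  + move=> n w _; rewrite lee_fin ger0_norm ?ge_min ?lexx ?orbT//.
- under eq_fun do rewrite integral_U.
  by rewrite fineK//; exact: tauN_int.
- move=> n; rewrite (eq_integral (fun w => (expR (2 * u * U n w))%:E)); last first.
    by move=> w _; rewrite -expRM_natl mulrA.
  rewrite integral_U fineK; last exact: integrable_fin_num.
  apply: ge0_le_integral => //.
  + exact: mexp_tau.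
  + by case/integrableP : (tau_dom (psi (2 * u))).
  + by move=> w _; rewrite lee_fin.
Qed.

End time_change.

End prob.

(** * Bernstein polynomials and laws determined by their Laplace transforms *)

Section bernstein.
Context {R : realType}.

(* Expectation of [g] at a binomial (n, x) variable, by conditioning on the first trial;
   [fun x => bernstein n (fun k => f (k / n)) x] is the n-th Bernstein polynomial of [f]. *)
Fixpoint bernstein (n : nat) (g : nat -> R) (x : R) : R :=
  if n is n'.+1 then (1 - x) * bernstein n' g x + x * bernstein n' (g \o S) x
  else g 0%N.

(** These are the first two moments of a binomial variable. The general quadratic is needed for the
    induction, since shifting the argument mixes the three coefficients. *)
Lemma bernstein_quadratic n (a b c x : R) :
  bernstein n (fun k => a + b * k%:R + c * k%:R ^+ 2) x =
  a + b * (n%:R * x) + c * (n%:R * x + n%:R * (n%:R - 1) * x ^+ 2).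
Proof.
elim: n a b c => [|n ih] a b c /=; first by rewrite !(mulr0, mul0r, expr0n, addr0)/=; ring.
rewrite ih (_ : _ \o S = (fun k => (a + b + c) + (b + 2 * c) * k%:R + c * k%:R ^+ 2)); last first.
  by apply/funext => k /=; rewrite -natr1; ring.
by rewrite ih -natr1; ring.
Qed.

Lemma bernstein_le n (g h : nat -> R) x : 0 <= x <= 1 ->
  (forall k, g k <= h k) -> bernstein n g x <= bernstein n h x.
Proof.
move=> /andP[x0 x1]; elim: n g h => [|n ih] g h gh //=.
by apply: lerD; apply: ler_wpM2l; rewrite ?subr_ge0//; apply: ih => k; exact: gh.
Qed.

Lemma bernstein_cvg (f : R -> R) (L x : R) : 0 <= x <= 1 -> 0 <= L ->
  (forall y z, `|f y - f z| <= L * `|y - z|) ->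
  bernstein n.+1 (fun k => f (k%:R / n.+1%:R)) x @[n --> \oo] --> f x.
Proof.
move=> x01 L0 fL; apply/cvgrPdist_le => e e0.
(* For large n the error is at most L (d + d) = e L / (L + 1); the 1 added to [L] allows [L = 0]. *)
pose d := e / (2 * (L + 1)).
have d0 : 0 < d by rewrite divr_gt0// mulr_gt0// ltr_wpDl.
have n_gt0 n : (0 : R) < n.+1%:R by [].
(* [|y - x| <= d + (y - x)^2 / d] reduces the error to the variance [x (1 - x) / n]. *)
pose q (n k : nat) : R := L * (d + (k%:R / n.+1%:R - x) ^+ 2 / d).
have qE n : bernstein n.+1 (fun k => q n k) x = L * (d + x * (1 - x) / (n.+1%:R * d)).
  rewrite (_ : (fun k => q n k) = (fun k : nat => L * (d + x ^+ 2 / d) +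
      (- (L * 2 * x / (n.+1%:R * d))) * k%:R + (L / (n.+1%:R ^+ 2 * d)) * k%:R ^+ 2)); last first.
    by apply/funext => k; rewrite /q; field; rewrite (gt_eqF d0) gt_eqF.
  by rewrite bernstein_quadratic; field; rewrite (gt_eqF d0) gt_eqF.
have aux y : `|f y - f x| <= L * (d + (y - x) ^+ 2 / d).
  apply: le_trans (fL y x) _; apply: ler_wpM2l => //.
  have [yd|yd] := leP `|y - x| d.
    by rewrite (le_trans yd)// lerDl mulr_ge0 ?sqr_ge0 ?invr_ge0 ?ltW.
  apply: ler_wpDl; first exact: ltW.
  rewrite -real_normK ?num_real// expr2 -mulrA; apply: ler_peMr => //.
  by rewrite ler_pdivlMr// mul1r ltW.
have shift n (g : nat -> R) (c : R) : bernstein n (fun k => c + g k) x = c + bernstein n g x.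
  by elim: n g => [|n ih] g //=; rewrite ih (ih (g \o S)); ring.
have neg n (g : nat -> R) : bernstein n (fun k => - g k) x = - bernstein n g x.
  by elim: n g => [|n ih] g //=; rewrite ih (ih (g \o S)); ring.
have bound n : `|f x - bernstein n.+1 (fun k => f (k%:R / n.+1%:R)) x| <=
    L * (d + x * (1 - x) / (n.+1%:R * d)).
  rewrite -qE distrC ler_norml; apply/andP; split.
    rewrite lerBrDl -neg -shift; apply: bernstein_le => // k.
    have := aux (k%:R / n.+1%:R); rewrite ler_norml => /andP[+ _].
    by rewrite /q lerBrDl.
  rewrite lerBlDl -shift; apply: bernstein_le => // k.
  have := aux (k%:R / n.+1%:R); rewrite ler_norml => /andP[_ +].
  by rewrite /q lerBlDl.
near=> n.
apply: le_trans (bound n) _.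
have vn : x * (1 - x) / (n.+1%:R * d) <= d.
  have nd0 : 0 < n.+1%:R * d by exact: mulr_gt0.
  have dd0 : 0 < d * d by exact: mulr_gt0.
  rewrite ler_pdivrMr//; apply: (@le_trans _ _ 1).
    by case/andP: x01 => x0 x1; rewrite mulr_ile1// ?subr_ge0// lerBlDr lerDl.
  rewrite mulrCA -ler_pdivrMr// mul1r.
  apply: le_trans (_ : n%:R <= _); last by rewrite ler_nat.
  by near: n; exact: nbhs_infty_ger.
apply: (@le_trans _ _ (L * (d + d))); first by rewrite ler_wpM2l// lerD2l.
rewrite -mulr2n -mulr_natl /d.
have -> : L * (2 * (e / (2 * (L + 1)))) = e * (L / (L + 1)).
  by field; rewrite gt_eqF// ltr_wpDl.
have L1 : 0 < L + 1 by rewrite ltr_wpDl.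
by apply: ler_piMr; [exact: ltW|rewrite ler_pdivrMr// mul1r lerDl].
Unshelve. all: by end_near. Qed.

Lemma bernstein_cst n (c x : R) : bernstein n (fun=> c) x = c.
Proof.
elim: n => [//|n ih] /=; rewrite (_ : _ \o S = fun=> c) ?ih//; ring.
Qed.

Lemma bernstein_bounded n (g : nat -> R) (M x : R) : 0 <= x <= 1 ->
  (forall k, `|g k| <= M) -> `|bernstein n g x| <= M.
Proof.
move=> x01 gM; rewrite ler_norml; apply/andP; split.
  rewrite -(bernstein_cst n (- M) x); apply: bernstein_le => // k.
  by have := gM k; rewrite ler_norml => /andP[].
rewrite -[leRHS](bernstein_cst n M x); apply: bernstein_le => // k.
by have := gM k; rewrite ler_norml => /andP[].
Qed.

Lemma measurable_bernstein n (g : nat -> R) : measurable_fun [set: R] (bernstein n g).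
Proof.
elim: n g => [|n ih] g /=; first exact: measurable_cst.
apply: measurable_funD; apply: measurable_funM => //.
exact: measurable_funB.
Qed.

End bernstein.

(** * Laws on the unit interval determined by their moments *)

Section laplace.
Context d (T : measurableType d) (R : realType) (P : probability T R).

Let integrable_bounded (f : T -> R) (M : R) : measurable_fun [set: T] f ->
  (forall w, `|f w| <= M) -> P.-integrable [set: T] (EFin \o f).
Proof.
move=> mf fM; apply: measurable_bounded_integrable => //.
  by rewrite ltey_eq fin_num_measure.
exists M; split; first exact: num_real.
by move=> x Mx w _; apply: le_trans (fM w) (ltW Mx).
Qed.

Let integrable_exp_bernstein (X : T -> R) n (g : nat -> R) (M : R) m :
  measurable_fun [set: T] X -> (forall w, 0 <= X w <= 1) -> (forall k, `|g k| <= M) ->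
  P.-integrable [set: T] (EFin \o (fun w => X w ^+ m * bernstein n g (X w))).
Proof.
move=> mX X01 gM; apply: (@integrable_bounded _ M).
  apply: measurable_funM; first exact: measurable_funX.
  exact: (measurableT_comp (measurable_bernstein n g)).
move=> w; rewrite normrM -[M]mul1r; apply: ler_pM => //; last exact: bernstein_bounded.
have /andP[x0 x1] := X01 w.
by rewrite normrX exprn_ile1// ger0_norm.
Qed.

(** Each step of the recursion multiplies by [1 - x] or [x]; the additional power [m] absorbs these
    factors and lets the induction close. *)
Let Rintegral_bernstein_eq (X Y : T -> R) :
  measurable_fun [set: T] X -> measurable_fun [set: T] Y ->
  (forall w, 0 <= X w <= 1) -> (forall w, 0 <= Y w <= 1) ->
  (forall m, \int[P]_w (X w ^+ m) = \int[P]_w (Y w ^+ m)) ->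
  forall n (g : nat -> R) (M : R) m, (forall k, `|g k| <= M) ->
  \int[P]_w (X w ^+ m * bernstein n g (X w)) = \int[P]_w (Y w ^+ m * bernstein n g (Y w)).
Proof.
move=> mX mY X01 Y01 XY.
have step (Z : T -> R) n (g : nat -> R) (M : R) m : measurable_fun [set: T] Z ->
    (forall w, 0 <= Z w <= 1) -> (forall k, `|g k| <= M) ->
    \int[P]_w (Z w ^+ m * bernstein n.+1 g (Z w)) =
    \int[P]_w (Z w ^+ m * bernstein n g (Z w)) -
    \int[P]_w (Z w ^+ m.+1 * bernstein n g (Z w)) +
    \int[P]_w (Z w ^+ m.+1 * bernstein n (g \o S) (Z w)).
  move=> mZ Z01 gM.
  rewrite -RintegralB//; [|exact: integrable_exp_bernstein gM..].
  rewrite -RintegralD//.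
  - by apply: eq_Rintegral => w _ /=; rewrite exprS; ring.
  - have := integrableB measurableT (@integrable_exp_bernstein _ n _ _ m mZ Z01 gM)
      (@integrable_exp_bernstein _ n _ _ m.+1 mZ Z01 gM).
    by apply: eq_integrable => // w _ /=; rewrite EFinB.
  - by apply: (@integrable_exp_bernstein _ _ _ M) => // k; exact: gM.
elim=> [|n ih] g M m gM.
  have ip (Z : T -> R) : measurable_fun [set: T] Z -> (forall w, 0 <= Z w <= 1) ->
      P.-integrable [set: T] (EFin \o (fun w => Z w ^+ m)).
    move=> mZ Z01; apply: (@integrable_bounded _ 1); first exact: measurable_funX.
    by move=> w; have /andP[x0 x1] := Z01 w; rewrite normrX exprn_ile1// ger0_norm.
  by rewrite /= (RintegralZr _ _ (ip X mX X01))// (RintegralZr _ _ (ip Y mY Y01))// XY.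
rewrite (step X _ _ M)// (step Y _ _ M)// !(ih _ M)// => k; exact: gM.
Qed.

Lemma Rintegral_lipschitz_eq (X Y : T -> R) (f : R -> R) (L M : R) :
  measurable_fun [set: T] X -> measurable_fun [set: T] Y ->
  (forall w, 0 <= X w <= 1) -> (forall w, 0 <= Y w <= 1) ->
  (forall m, \int[P]_w (X w ^+ m) = \int[P]_w (Y w ^+ m)) ->
  0 <= L -> (forall y z, `|f y - f z| <= L * `|y - z|) -> (forall y, `|f y| <= M) ->
  measurable_fun [set: R] f ->
  \int[P]_w f (X w) = \int[P]_w f (Y w).
Proof.
move=> mX mY X01 Y01 XY L0 fL fM mf.
have cv (Z : T -> R) : measurable_fun [set: T] Z -> (forall w, 0 <= Z w <= 1) ->
    (\int[P]_w (bernstein n.+1 (fun k => f (k%:R / n.+1%:R)) (Z w))%:E)%E @[n --> \oo] -->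
    (\int[P]_w (f (Z w))%:E)%E.
  move=> mZ Z01; apply: (@dominated_cvg _ _ _ P setT _ _ _ (fun=> M%:E)) => //.
  - move=> n; apply/measurable_EFinP.
    exact: (measurableT_comp (measurable_bernstein _ _)).
  - by move=> w _; apply: cvg_EFin; [exact: nearW|apply: bernstein_cvg L0 fL].
  - exact: (finite_measure_integrable_cst P M measurableT).
  - by move=> n w _; rewrite lee_fin; apply: bernstein_bounded.
congr fine.
have := cv Y mY Y01; have := cv X mX X01.
rewrite (_ : (fun n => _) = (fun n =>
  (\int[P]_w (bernstein n.+1 (fun k => f (k%:R / n.+1%:R)) (Y w))%:E)%E)).
  by move=> h1 h2; exact: cvg_unique h1 h2.
apply/funext => n.
have bfin (Z : T -> R) : measurable_fun [set: T] Z -> (forall w, 0 <= Z w <= 1) ->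
    (\int[P]_w (bernstein n.+1 (fun k => f (k%:R / n.+1%:R)) (Z w))%:E)%E \is a fin_num.
  move=> mZ Z01; apply: integrable_fin_num => //; apply: (@integrable_bounded _ M).
    exact: (measurableT_comp (measurable_bernstein _ _)).
  by move=> w; exact: bernstein_bounded.
rewrite -[LHS]fineK ?bfin// -[RHS]fineK ?bfin//; congr EFin.
have := @Rintegral_bernstein_eq X Y mX mY X01 Y01 XY n.+1 (fun k => f (k%:R / n.+1%:R)) M 0%N.
move=> /(_ (fun k => fM _)); rewrite /Rintegral; under eq_integral do rewrite expr0 mul1r.
by under [X in _ = fine X]eq_integral do rewrite expr0 mul1r.
Qed.

Lemma probability_ge_eq (X Y : T -> R) (c : R) :
  measurable_fun [set: T] X -> measurable_fun [set: T] Y ->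
  (forall w, 0 <= X w <= 1) -> (forall w, 0 <= Y w <= 1) ->
  (forall m, \int[P]_w (X w ^+ m) = \int[P]_w (Y w ^+ m)) ->
  P [set w | c <= X w] = P [set w | c <= Y w].
Proof.
move=> mX mY X01 Y01 XY.
(* A Lipschitz ramp of slope [j], equal to 1 from [c] on and, for positive [j], to 0 below c - 1/j;
   it tends to the indicator of [c <= x]. *)
pose f (j : nat) (x : R) : R := Num.min 1 (Num.max 0 (1 + j%:R * (x - c))).
have mf j : measurable_fun [set: R] (f j).
  apply: measurable_minr => //; apply: measurable_maxr => //.
  by apply: measurable_funD => //; apply: measurable_funM => //; exact: measurable_funB.
have f01 j x : 0 <= f j x <= 1.
  by rewrite /f le_min ler01 le_max lexx ge_min lexx.
have fL j y z : `|f j y - f j z| <= j%:R * `|y - z|.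
  wlog yz : y z / z <= y => [hw|].
    have [|/ltW] := leP z y; first exact: hw.
    by rewrite distrC [`|y - z|]distrC; exact: hw.
  have fyz : f j z <= f j y.
    rewrite /f le_min ge_min lexx/= ge_min; apply/orP; right.
    rewrite ge_max le_max lexx/= le_max; apply/orP; right.
    by rewrite lerD2l ler_wpM2l// lerD2r.
  rewrite !ger0_norm ?subr_ge0// lerBlDr.
  have jyz : 0 <= j%:R * (y - z) by rewrite mulr_ge0 ?subr_ge0.
  rewrite [X in _ + X]/f addr_minr le_min; apply/andP; split.
    by have /andP[_ f1] := f01 j y; rewrite (le_trans f1)// lerDr.
  rewrite /f ge_min; apply/orP; right; rewrite ge_max; apply/andP; split.
    by rewrite addr_ge0// le_max lexx.
  rewrite (_ : 1 + j%:R * (y - c) = j%:R * (y - z) + (1 + j%:R * (z - c))); last by ring.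
  by rewrite lerD2l le_max lexx orbT.
have cv (Z : T -> R) : measurable_fun [set: T] Z ->
    (\int[P]_w (f j (Z w))%:E)%E @[j --> \oo] --> P [set w | c <= Z w].
  move=> mZ.
  have mE : measurable [set w | c <= Z w].
    have -> : [set w | c <= Z w] = Z @^-1` `[c, +oo[.
      by apply/seteqP; split => w; rewrite /= in_itv/= andbT.
    by rewrite -[X in measurable X]setTI; exact: mZ.
  have -> : P [set w | c <= Z w] = (\int[P]_w (\1_[set w | c <= Z w] w)%:E)%E.
    by rewrite integral_indic// setIT.
  apply: (@dominated_cvg _ _ _ P setT _ _ _ (fun=> 1%:E)) => //.
  - by move=> j; apply/measurable_EFinP; exact: (measurableT_comp (mf j)).
  - move=> w _; apply: cvg_EFin; first exact: nearW.
    rewrite /= indicE; have [cZ|cZ] := leP c (Z w).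
      rewrite mem_set//; apply: cvg_near_cst; apply: nearW => j /=.
      rewrite /f; apply/min_idPl; by rewrite le_max lerDl mulr_ge0 ?orbT ?subr_ge0.
    rewrite memNset/=; last by rewrite leNgt cZ.
    apply: cvg_near_cst; exists (Num.truncn (c - Z w)^-1).+1 => // j /= jZ.
    rewrite /f; rewrite (_ : Num.max 0 _ = 0); first by apply/min_idPr.
    apply/max_idPl; rewrite -opprB mulrN subr_le0 -ler_pdivrMr ?subr_gt0// div1r.
    by apply: (le_trans (ltW (truncnS_gt _))); rewrite ler_nat.
  - exact: (finite_measure_integrable_cst P 1 measurableT).
  - move=> j w _; rewrite lee_fin; have /andP[f0 f1] := f01 j (Z w).
    by rewrite ger0_norm.
have := cv Y mY; have := cv X mX.
rewrite (_ : (fun j => _) = (fun j => (\int[P]_w (f j (Y w))%:E)%E)).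
  by move=> h1 h2; exact: cvg_unique h1 h2.
apply/funext => j.
have bfin (Z : T -> R) : measurable_fun [set: T] Z ->
    (\int[P]_w (f j (Z w))%:E)%E \is a fin_num.
  move=> mZ; apply: integrable_fin_num => //; apply: (@integrable_bounded _ 1).
    exact: (measurableT_comp (mf j)).
  by move=> w; have /andP[f0 f1] := f01 j (Z w); rewrite ger0_norm.
rewrite -[LHS]fineK ?bfin// -[RHS]fineK ?bfin//; congr EFin.
apply: (@Rintegral_lipschitz_eq X Y (f j) j%:R 1) => //.
by move=> y; have /andP[f0 f1] := f01 j y; rewrite ger0_norm.
Qed.

End laplace.

(** * Moments of the inverse stable subordinator *)

Section inverse_stable.
Context d (T : measurableType d) (R : realType) (P : probability T R).
Variables (alpha : R) (D : R -> T -> R).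
Hypothesis alpha_gt0 : 0 < alpha.
Hypothesis stableD : stable_subordinator P alpha D.

Let Y := inverse_subordinator D.

Let levyD : levy_process P D. Proof. by case: stableD. Qed.

Let D_homo w (s t : R) : 0 <= s -> s <= t -> D s w <= D t w.
Proof. by case: stableD => _ + _; exact. Qed.

Let measurable_D t : 0 <= t -> measurable_fun [set: T] (D t).
Proof. by move=> t0; exact: (levy_measurable levyD). Qed.

Let laplace_D s t : 0 <= s -> 0 <= t ->
  (\int[P]_w (expR (- (s * D t w)))%:E = (expR (- (t * s `^ alpha)))%:E)%E.
Proof. by case: stableD => _ _ + s0 t0 => /(_ s t s0 t0); rewrite unlock. Qed.

Let measurable_expRN (f : T -> R) (s : R) : measurable_fun [set: T] f ->
  measurable_fun [set: T] (fun w => (expR (- (s * f w)))%:E).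
Proof.
move=> mf; apply/measurable_EFinP; apply: measurableT_comp => //.
by apply: measurableT_comp => //; exact: measurable_funM.
Qed.

Let D_ge0 : {ae P, forall w, forall t, 0 <= t -> 0 <= D t w}.
Proof.
have := levy_start levyD; apply: filterS => w D0 t t0.
by rewrite -D0 D_homo.
Qed.

Let measurable_le (f : T -> R) c : measurable_fun [set: T] f -> measurable [set w | f w <= c].
Proof.
move=> mf; have -> : [set w | f w <= c] = f @^-1` `]-oo, c].
  by apply/seteqP; split => w; rewrite /= in_itv.
by rewrite -[X in measurable X]setTI; exact: mf.
Qed.

Let measurable_gt (f : T -> R) c : measurable_fun [set: T] f -> measurable [set w | c < f w].
Proof.
move=> mf; have -> : [set w | c < f w] = f @^-1` `]c, +oo[.
  by apply/seteqP; split => w; rewrite /= in_itv/= andbT.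
by rewrite -[X in measurable X]setTI; exact: mf.
Qed.

Let measurable_ge (f : T -> R) c : measurable_fun [set: T] f -> measurable [set w | c <= f w].
Proof.
move=> mf; have -> : [set w | c <= f w] = f @^-1` `[c, +oo[.
  by apply/seteqP; split => w; rewrite /= in_itv/= andbT.
by rewrite -[X in measurable X]setTI; exact: mf.
Qed.

(** Exponential Markov inequality: the indicator of the event is at most exp(s (c - D t)). *)
Let P_D_le s t c : 0 <= s -> 0 <= t ->
  (P [set w | D t w <= c]%R <= (expR (s * c - t * s `^ alpha))%:E)%E.
Proof.
move=> s0 t0; set E := [set w | _].
have mE : measurable E by exact: measurable_le (measurable_D t0).
have -> : P E = (\int[P]_w (\1_E w)%:E)%E by rewrite integral_indic// setIT.
rewrite expRD EFinM -(laplace_D s0 t0) -ge0_integralZl//; last first.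
  exact: measurable_expRN (measurable_D t0).
apply: ge0_le_integral => //.
- by apply/measurable_EFinP; exact: measurable_indic.
- by apply: measurable_funeM; exact: measurable_expRN (measurable_D t0).
- move=> w _; rewrite -EFinM -expRD lee_fin indicE.
  have [/set_mem Ew|_] := boolP (w \in E); last exact: expR_ge0.
  by rewrite -[X in X <= _]expR0 ler_expR subr_ge0 ler_wpM2l.
Qed.

Let cvg_expRN_nat (a : R) : expR (a - n%:R) @[n --> \oo] --> 0.
Proof.
rewrite -(mulr0 (expR a)); under eq_fun do rewrite expRD.
by apply: cvgM; [exact: cvg_cst|exact: cvgn_expR].
Qed.

(** This is the event where the infimum defining the inverse runs over the empty set and takes its
    default value 0. At [s = 1] the exponential bound is exp(t - n). *)
Let P_D_bounded t : P (\bigcap_n [set w | D n%:R w <= t]) = 0%E.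
Proof.
apply/eqP; rewrite eq_le measure_ge0 andbT.
have c0 : (expR (t - n%:R))%:E @[n --> \oo] --> (0 : \bar R)%E.
  by apply: cvg_EFin; [exact: nearW|exact: cvg_expRN_nat].
apply: (lee_cvg_to (cvg_cst _) c0); apply: nearW => n.
apply: (@le_trans _ _ (P [set w | D n%:R w <= t])).
  apply: le_measure; rewrite ?inE.
  - by apply: bigcapT_measurable => m; exact: measurable_le (measurable_D _).
  - exact: measurable_le (measurable_D _).
  - by move=> w; apply.
by have := @P_D_le 1 n%:R t ler01 (ler0n _ _); rewrite mul1r powR1 mulr1.
Qed.

Let D1_gt0 : {ae P, forall w, 0 < D 1 w}.
Proof.
exists [set w | D 1 w <= 0]; split.
- exact: measurable_le (measurable_D _).
- apply/eqP; rewrite eq_le measure_ge0 andbT.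
  have c0 : (expR (0 - n%:R))%:E @[n --> \oo] --> (0 : \bar R)%E.
    by apply: cvg_EFin; [exact: nearW|exact: cvg_expRN_nat].
  apply: (lee_cvg_to (cvg_cst _) c0); apply: nearW => n.
  (* At level 0 and time 1, taking s = n^(1 / alpha) turns the bound into exp(- n). *)
  have := @P_D_le (n%:R `^ alpha^-1) 1 0 (powR_ge0 _ _) ler01.
  by rewrite mulr0 mul1r powRrVK// gt_eqF.
- by move=> w /= /negP; rewrite -leNgt.
Qed.

(* Self-similarity: [D x] and [x ^ (1 / alpha) * D 1] have the same Laplace transform. *)
Let P_D_scale x t : 0 < x -> 0 <= t ->
  P [set w | D x w <= t] = P [set w | x `^ alpha^-1 * D 1 w <= t].
Proof.
move=> x0 t0.
(* Clipping at 0 puts [e f] into [[0, 1]], as [probability_ge_eq] requires. It leaves the event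
   [f w <= t] unchanged for [0 <= t], and the powers of [e f] still integrate to Laplace transforms
   because [f] is almost surely nonnegative. *)
pose e (f : T -> R) w := expR (- Num.max (f w) 0).
have eE (f : T -> R) : [set w | f w <= t] = [set w | expR (- t) <= e f w].
  apply/seteqP; split => w; rewrite /e /= ler_expR lerN2 ge_max; last by case/andP.
  by move=> ->; rewrite t0.
have me (f : T -> R) : measurable_fun [set: T] f -> measurable_fun [set: T] (e f).
  move=> mf; apply: measurableT_comp => //; apply: measurableT_comp => //.
  exact: measurable_maxr.
have e01 (f : T -> R) w : 0 <= e f w <= 1.
  by rewrite expR_ge0/= -expR0 ler_expR oppr_le0 le_max lexx orbT.
have mDx := measurable_D (ltW x0); have mD1 := measurable_D ler01.
have mxD1 : measurable_fun [set: T] (fun w => x `^ alpha^-1 * D 1 w) by exact: measurable_funM.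
rewrite !eE; apply: probability_ge_eq; [exact: me|exact: me|exact: e01|exact: e01|].
have em (f : T -> R) m : measurable_fun [set: T] f -> {ae P, forall w, 0 <= f w} ->
    \int[P]_w (e f w ^+ m) = fine (\int[P]_w (expR (- (m%:R * f w)))%:E)%E.
  move=> mf f0; rewrite /Rintegral; congr fine; apply: ge0_ae_eq_integral => //.
  - by apply/measurable_EFinP; apply: measurable_funX; exact: me.
  - exact: measurable_expRN.
  - by move=> w _; rewrite lee_fin exprn_ge0 ?expR_ge0.
  - apply: filterS f0 => w fw _; rewrite /e; congr EFin.
    by rewrite -expRM_natl mulrN max_l.
have D0x : {ae P, forall w, 0 <= D x w}.
  by apply: filterS D_ge0 => w; apply; exact: ltW.
have D01 : {ae P, forall w, 0 <= x `^ alpha^-1 * D 1 w}.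
  by apply: filterS D_ge0 => w D0; rewrite mulr_ge0 ?powR_ge0 ?D0.
move=> m; rewrite (em _ m mDx D0x) (em _ m mxD1 D01); congr fine.
rewrite (laplace_D (ler0n _ m) (ltW x0)).
rewrite (eq_integral (fun w => (expR (- ((m%:R * x `^ alpha^-1) * D 1 w)))%:E)); last first.
  by move=> w _; rewrite mulrA.
have mx0 : 0 <= m%:R * x `^ alpha^-1 by rewrite mulr_ge0 ?powR_ge0.
apply: (@etrans _ _ (expR (- (1 * (m%:R * x `^ alpha^-1) `^ alpha)))%:E).
  congr (expR (- _))%:E; rewrite mul1r powRM ?powR_ge0//.
  by rewrite powRrVK ?gt_eqF ?ltW// mulrC.
by rewrite -(laplace_D mx0 ler01).
Qed.

Lemma inverse_subordinator_ge0 t w : 0 <= Y t w.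
Proof.
rewrite /Y /inverse_subordinator; set A := [set _ | _].
have [->|/set0P A0] := eqVneq A set0; first by rewrite inf0.
by apply: lb_le_inf => // x [].
Qed.

(** Monotone paths allow a countable set of fractions to witness that [t] is exceeded before [x],
    which is what measurability needs. The second alternative is the path that never exceeds [t],
    where the default infimum 0 lies below [x]. *)
Let Y_lt t w x : 0 < x -> Y t w < x <->
  (exists m j : nat, j%:R / m.+1%:R < x /\ t < D (j%:R / m.+1%:R) w) \/
  (\bigcap_n [set w | D n%:R w <= t]) w.
Proof.
move=> x0; rewrite /Y /inverse_subordinator; set A := [set _ | _]; split.
  have [A0 _|/set0P A0] := eqVneq A set0.
    right => n _ /=; rewrite leNgt; apply/negP => tD.
    by have : A n%:R by []; rewrite A0.
  move=> Ax; have [z [z0 tz] zx] := inf_lt A0 Ax; left.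
  pose m := Num.truncn (x - z)^-1; pose j := (Num.truncn (z * m.+1%:R)).+1.
  have m0 : (0 : R) < m.+1%:R by [].
  have zj : z < j%:R / m.+1%:R by rewrite ltr_pdivlMr// truncnS_gt.
  exists m, j; split; last by apply: lt_le_trans tz _; apply: D_homo => //; exact: ltW.
  apply: (@le_lt_trans _ _ (z + m.+1%:R^-1)).
    rewrite ler_pdivrMr// mulrDl mulVf ?gt_eqF// /j -natr1 lerD2r.
    by rewrite truncn_le// mulr_ge0.
  rewrite -ltrBrDl -[ltRHS]invrK ltf_pV2 ?posrE ?invr_gt0 ?subr_gt0//.
  exact: truncnS_gt.
have lbA : has_lbound A by exists 0 => z [].
move=> [[m [j [jx tj]]]|bw].
  by apply: le_lt_trans jx; apply: ge_inf => //; split => //; rewrite divr_ge0.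
have -> : A = set0; last by rewrite inf0.
apply/seteqP; split => // z [z0 tz].
have := bw (Num.truncn z).+1 I; rewrite /= leNgt => /negP; apply.
by apply: lt_le_trans tz _; apply: D_homo => //; exact/ltW/truncnS_gt.
Qed.

Lemma measurable_inverse_subordinator t : measurable_fun [set: T] (Y t).
Proof.
have mlt x : 0 < x -> measurable [set w | Y t w < x].
  move=> x0.
  have -> : [set w | Y t w < x] =
      (\bigcup_m \bigcup_j (if (j%:R / m.+1%:R : R) < x
         then [set w | t < D (j%:R / m.+1%:R) w] else set0)) `|`
      (\bigcap_n [set w | D n%:R w <= t]).
    apply/seteqP; split => w.
      move=> /(Y_lt _ _ x0) [[m [j [jx tj]]]|bw]; [left|by right].
      by exists m => //; exists j => //; rewrite jx.
    move=> H; apply/(Y_lt _ _ x0); case: H => [[m _ [j _]]|]; [|by right].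
    by case: ifPn => // jx tj; left; exists m, j.
  apply: measurableU; last first.
    by apply: bigcapT_measurable => n; exact: measurable_le (measurable_D _).
  apply: bigcupT_measurable => m; apply: bigcupT_measurable => j.
  by case: ifPn => // _; apply: measurable_gt; apply: measurable_D; rewrite divr_ge0.
move=> mT; apply: (measurability _ (RGenInftyO.measurableE R)) => // _ [_ [x ->] <-].
rewrite setTI; have [x0|x0] := ltP 0 x.
  have -> : Y t @^-1` `]-oo, x[ = [set w | Y t w < x].
    by apply/seteqP; split => w; rewrite /= in_itv.
  exact: mlt.
have -> : Y t @^-1` `]-oo, x[ = set0; last exact: measurable0.
apply/seteqP; split => // w; rewrite /= in_itv/= ltNge.
by rewrite (le_trans x0)// inverse_subordinator_ge0.
Qed.

(** Together with the next bound this places the event [D x w <= t] between a strict and a large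
    inequality for [Y t w]; the case [Y t w = x] stays undecided. *)
Let P_inverse_gt t x : 0 < x -> (P [set w | x < Y t w]%R <= P [set w | D x w <= t]%R)%E.
Proof.
move=> x0; apply: le_measure; rewrite ?inE.
- exact: measurable_gt (measurable_inverse_subordinator t).
- exact: measurable_le (measurable_D (ltW x0)).
- move=> w /= xY; rewrite leNgt; apply/negP => tD.
  move: xY; rewrite ltNge => /negP; apply; apply: ge_inf; first by exists 0 => z [].
  by split => //; exact: ltW.
Qed.

(** A path that never exceeds [t] has inverse 0 and violates the inclusion of events, so the null
    event of [P_D_bounded] is added. *)
Let P_inverse_ge t x : 0 < x -> (P [set w | D x w <= t]%R <= P [set w | x <= Y t w]%R)%E.
Proof.
move=> x0; set E := [set w | x <= Y t w].
have mE : measurable E by exact: measurable_ge (measurable_inverse_subordinator t).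
have mB : measurable (\bigcap_n [set w | D n%:R w <= t]).
  by apply: bigcapT_measurable => n; exact: measurable_le (measurable_D _).
rewrite -[leRHS]adde0 -(P_D_bounded t).
apply: le_trans (measureU2 _ mE mB); apply: le_measure; rewrite ?inE.
- exact: measurable_le (measurable_D (ltW x0)).
- exact: measurableU.
- move=> w /= Dxt; have [xY|Yx] := leP x (Y t w); [by left|right].
  have [[m [j [jx tj]]]|//] := (Y_lt t w x0).1 Yx.
  have := D_homo w (divr_ge0 (ler0n _ j) (ler0n _ m.+1)) (ltW jx).
  by move=> /(lt_le_trans tj); rewrite ltNge Dxt.
Qed.

Let Z t w : R := t `^ alpha * D 1 w `^ (- alpha).

Let Z_ge0 t w : 0 <= Z t w. Proof. by rewrite mulr_ge0 ?powR_ge0. Qed.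

Let measurable_Z t : measurable_fun [set: T] (Z t).
Proof.
apply: measurable_funM => //; apply: measurable_fun_powR.
exact: measurable_D.
Qed.

Let P_ae_eq (A B : set T) : measurable A -> measurable B ->
  {ae P, forall w, A w <-> B w} -> P A = P B.
Proof.
move=> mA mB AB.
have E (C : set T) : measurable C -> P C = (\int[P]_w (\1_C w)%:E)%E.
  by move=> mC; rewrite integral_indic// setIT.
rewrite (E A)// (E B)//; apply: ge0_ae_eq_integral => //.
- by apply/measurable_EFinP; exact: measurable_indic.
- by apply/measurable_EFinP; exact: measurable_indic.
- apply: filterS AB => w ABw _; rewrite !indicE; congr (_%:R)%:E.
  by congr nat_of_bool; apply/idP/idP; rewrite !inE => /ABw.
Qed.

Let P_Z_ge t x : 0 <= t -> 0 < x -> P [set w | x <= Z t w] = P [set w | D x w <= t].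
Proof.
move=> t0 x0; rewrite P_D_scale//.
have mxD1 : measurable_fun [set: T] (fun w => x `^ alpha^-1 * D 1 w).
  by apply: measurable_funM => //; exact: measurable_D.
apply: P_ae_eq; [exact: measurable_ge|exact: measurable_le|].
apply: filterS D1_gt0 => w D0; rewrite /Z /= powRN.
have E : (x <= t `^ alpha / D 1 w `^ alpha) = (x `^ alpha^-1 * D 1 w <= t).
  have D0' := ltW D0; have xD0 : 0 <= x `^ alpha^-1 * D 1 w by rewrite mulr_ge0 ?powR_ge0.
  rewrite ler_pdivlMr ?powR_gt0// -[in LHS](@powRrVK _ alpha x) ?gt_eqF//; last exact: ltW.
  by rewrite -powRM ?powR_ge0// !leNgt ltr_powR_mono.
by rewrite E.
Qed.

(** Moving from [x] to [x + m.+1%:R^-1] absorbs the difference between strict and large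
    inequalities, so tails are compared without knowing that the laws have no atoms. *)
Let P_gt_le (U V : T -> R) : measurable_fun [set: T] U -> measurable_fun [set: T] V ->
  (forall x, 0 < x -> (P [set w | x < U w]%R <= P [set w | x <= V w]%R)%E) ->
  forall x, 0 <= x -> (P [set w | x < U w]%R <= P [set w | x < V w]%R)%E.
Proof.
move=> mU mV UV x x0.
pose F m := [set w | x + m.+1%:R^-1 < U w].
have mF m : measurable (F m) by exact: measurable_gt.
have UF : [set w | x < U w] = \bigcup_m F m.
  apply/seteqP; split => w /=.
    rewrite -subr_gt0 => xU; exists (Num.truncn (U w - x)^-1) => //=.
    rewrite /F/= -ltrBrDl -[ltRHS]invrK ltf_pV2 ?posrE ?invr_gt0//.
    exact: truncnS_gt.
  by move=> [m _]; apply: lt_trans; rewrite ltrDl.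
have cF : P (F m) @[m --> \oo] --> P (\bigcup_m F m).
  apply: nondecreasing_cvg_mu => //.
    exact: bigcupT_measurable.
  apply/nondecreasing_seqP => m; apply/subsetPset => w; apply: le_lt_trans.
  by rewrite lerD2l lef_pV2 ?posrE// ler_nat.
rewrite UF; apply: (lee_cvg_to cF (cvg_cst _)); apply: nearW => m.
apply: le_trans (UV _ _) _; first by rewrite ltr_wpDl.
apply: le_measure; rewrite ?inE; [exact: measurable_ge|exact: measurable_gt|].
by move=> w /=; apply: lt_le_trans; rewrite ltrDl.
Qed.

Let P_gt_eq t x : 0 <= t -> 0 <= x -> P [set w | x < Y t w] = P [set w | x < Z t w].
Proof.
move=> t0 x0; apply/eqP; rewrite eq_le; apply/andP; split.
- apply: P_gt_le x0 => [||y y0]; [exact: measurable_inverse_subordinator|exact: measurable_Z|].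
  by rewrite P_Z_ge//; exact: P_inverse_gt.
- apply: P_gt_le x0 => [||y y0]; [exact: measurable_Z|exact: measurable_inverse_subordinator|].
  apply: (@le_trans _ _ (P [set w | y <= Z t w])); last first.
    by rewrite P_Z_ge//; exact: P_inverse_ge.
  apply: le_measure; rewrite ?inE; [exact: measurable_gt|exact: measurable_ge|].
  by move=> w /=; exact: ltW.
Qed.

(** Only strict tail probabilities enter, so their equality for [Y t] and [Z t] is enough to equate
    moments. *)
Let integral_pow_ccdf (U : T -> R) n : measurable_fun [set: T] U -> (forall w, 0 <= U w) ->
  (\int[P]_w (U w ^+ n.+1)%:E =
   \int[lebesgue_measure]_(r in `[0%R, +oo[) P [set w | r `^ n.+1%:R^-1 < U w]%R)%E.
Proof.
move=> mU U0.
have mUn : measurable_fun [set: T] (fun w => U w ^+ n.+1) by exact: measurable_funX.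
pose X : {RV P >-> R} := mfun_Sub (mem_set mUn).
have := @ge0_expectation_ccdf _ _ _ P X.
rewrite unlock => -> /=; last by move=> w; exact: exprn_ge0.
apply: eq_integral => r; rewrite inE/= in_itv/= andbT => r0.
rewrite /ccdf /distribution /pushforward; congr (P _).
apply/seteqP; split => w; rewrite /= in_itv/= andbT;
by rewrite -powR_mulrn// -[X in X < _ `^ _](@powRrVK _ n.+1%:R r)// ltr_powR_mono// powR_ge0.
Qed.

Let integral_pow_eq t n : 0 <= t ->
  (\int[P]_w (Y t w ^+ n)%:E = \int[P]_w (Z t w ^+ n)%:E)%E.
Proof.
move=> t0; case: n => [|n]; first by apply: eq_integral => w _; rewrite !expr0.
rewrite !integral_pow_ccdf//; last 2 first.
- exact: measurable_inverse_subordinator.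
- exact: inverse_subordinator_ge0.
apply: eq_integral => r; rewrite inE/= in_itv/= andbT => r0.
by rewrite P_gt_eq// powR_ge0.
Qed.

(** The mixture formula for a negative power is integrated over the law of [D 1]. After Tonelli the
    Laplace transform appears at x^(1 / alpha), where it equals exp(- x), and a Gamma integral
    remains. *)
Lemma integral_stable_powR (a : R) : 0 < a ->
  ((Gamma (alpha * a + 1))%:E * \int[P]_w (D 1 w `^ (- (alpha * a)))%:E
   = (Gamma (a + 1))%:E)%E.
Proof.
move=> a0; have aa0 : 0 < alpha * a + 1 by rewrite addr_gt0 ?mulr_gt0.
pose g (w : T) (x : R) : R := a * x `^ (a - 1) * expR (- (x `^ alpha^-1 * D 1 w)).
pose f (p : T * R) : \bar R := (if 0 < p.2 then g p.1 p.2 else 0)%:E.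
have g0 w x : 0 <= g w x by rewrite !mulr_ge0 ?powR_ge0 ?expR_ge0 ?ltW.
have f0 p : (0 <= f p)%E by rewrite /f lee_fin; case: ifPn => // _; exact: g0.
have mD1 := measurable_D ler01.
have mf : measurable_fun [set: T * R] f.
  apply/measurable_EFinP; apply: measurable_fun_ifT => //.
    exact: measurable_fun_ltr.
  apply: measurable_funM.
    by apply: measurable_funM => //; apply: measurable_fun_powR.
  apply: measurableT_comp => //; apply: measurableT_comp => //.
  apply: measurable_funM; first exact: measurable_fun_powR.
  exact: (measurableT_comp mD1 measurable_fst).
have FT := fubini_tonelli (m1 := P) (m2 := @lebesgue_measure R) f mf f0.
transitivity (\int[P]_w \int[lebesgue_measure]_y f (w, y))%E.
  rewrite -ge0_integralZl//; last 3 first.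
  - by apply/measurable_EFinP; exact: measurable_fun_powR.
  - by move=> w _; rewrite lee_fin powR_ge0.
  - by rewrite lee_fin ltW// Gamma_gt0.
  apply: ge0_ae_eq_integral => //.
  - by apply: measurable_funeM; apply/measurable_EFinP; exact: measurable_fun_powR.
  - exact: (measurable_fun_fubini_tonelli_F (m2 := @lebesgue_measure R) f mf f0).
  - by move=> w _; rewrite mule_ge0// lee_fin ?powR_ge0// ltW// Gamma_gt0.
  - by move=> w _; apply: integral_ge0.
  - apply: filterS D1_gt0 => w D0 _.
    rewrite -EFinM -integral_powR_expR_powR//.
    rewrite (@integral_mkcondb R (fun x => 0 < x)); last first.
      by move=> x; rewrite /= in_itv/= andbT.
    by apply: eq_integral => x _; rewrite /f /g/=; case: ifPn.
rewrite FT GammaS// EFinM -integral_Gamma// -ge0_integralZl//; last 3 first.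
- exact: measurable_powR_expRN.
- by move=> x _; exact: powR_expRN_ge0.
- by rewrite lee_fin ltW.
rewrite [RHS](@integral_mkcondb R (fun x => 0 < x)); last first.
  by move=> x; rewrite /= in_itv/= andbT.
apply: eq_integral => x _; rewrite /f/=; case: ifPn => x0; last by rewrite integral0.
have E : (\int[P]_w (g w x)%:E = \int[P]_w ((a * x `^ (a - 1))%:E * (expR (- (x `^ alpha^-1 * D 1 w)))%:E))%E.
  by apply: eq_integral => w _; rewrite -EFinM.
rewrite E ge0_integralZl//; last 2 first.
- exact: (measurable_expRN _ mD1).
- by rewrite lee_fin mulr_ge0 ?powR_ge0 ?ltW.
rewrite (laplace_D (powR_ge0 _ _) ler01) mul1r powRrVK ?gt_eqF ?ltW//.
by rewrite -!EFinM mulrA.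
Qed.

Lemma inverse_subordinator_moment t n : 0 <= t ->
  (\int[P]_w (Y t w ^+ n)%:E = (n`!%:R * (t `^ alpha) ^+ n / Gamma (n%:R * alpha + 1))%:E)%E.
Proof.
move=> t0; have [->|n0] := eqVneq n 0%N.
  rewrite mul0r (Gamma_nat 0) expr0 mulr1 divr1 -[RHS](integral_prob_cst P).
  by apply: eq_integral => w _; rewrite expr0.
have nR0 : (0 : R) < n%:R by rewrite ltr0n lt0n.
rewrite integral_pow_eq//.
have E : (\int[P]_w (Z t w ^+ n)%:E =
    \int[P]_w (((t `^ alpha) ^+ n)%:E * (D 1 w `^ (- (alpha * n%:R)))%:E))%E.
  apply: eq_integral => w _; rewrite -EFinM /Z exprMn -mulNr powRrM.
  by rewrite powR_mulrn ?powR_ge0.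
rewrite E ge0_integralZl//; last 3 first.
- by apply/measurable_EFinP; apply: measurable_fun_powR; exact: measurable_D.
- by move=> w _; rewrite lee_fin powR_ge0.
- by rewrite lee_fin exprn_ge0 ?powR_ge0.
have G0 : 0 < Gamma (n%:R * alpha + 1) :> R by rewrite Gamma_gt0// addr_gt0 ?mulr_gt0.
have := integral_stable_powR nR0; rewrite Gamma_nat [alpha * _]mulrC => H.
rewrite -mulrA mulrCA EFinM; congr (_ * _)%E.
by rewrite [n`!%:R * _]mulrC EFinM -H muleA -EFinM mulVf ?gt_eqF// mul1e.
Qed.

End inverse_stable.

(** * The Mittag-Leffler function *)

Section entire.
Context {R : realType}.
Implicit Types (c : nat -> R) (x : R).

(** Infinite radius of convergence, phrased as domination by every geometric sequence; this form
    passes directly to derived and rescaled coefficients. *)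
Definition entire_coef c := forall rho : R, 0 < rho -> exists C, forall n, `|c n| <= C * rho ^+ n.

Lemma entire_normed_cvg c x : entire_coef c -> cvgn (pseries (fun n => `|c n|) `|x|).
Proof.
(* With this ratio the terms at [x] are bounded by C / 2^n. *)
move=> ec; have rho0 : 0 < (2 * (`|x| + 1))^-1 by rewrite invr_gt0 mulr_gt0// ltr_wpDl.
have [C HC] := ec _ rho0.
have C0 : 0 <= C by have := le_trans (normr_ge0 _) (HC 0%N); rewrite expr0 mulr1.
apply: (@series_le_cvg _ _ (geometric C 2^-1)).
- by move=> n; rewrite mulr_ge0.
- by move=> n; rewrite /geometric/= mulr_ge0.
- move=> n; rewrite /geometric/=; apply: le_trans (ler_wpM2r _ (HC n)) _; first by rewrite exprn_ge0.
  rewrite -mulrA ler_wpM2l//.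
  rewrite -exprMn lerXn2r ?nnegrE ?mulr_ge0 ?invr_ge0 ?mulr_ge0 ?addr_ge0//.
  rewrite invfM -mulrA ler_piMr ?invr_ge0// mulrC ler_pdivrMr ?ltr_wpDl// mul1r.
  by rewrite lerDl.
- by apply: is_cvg_geometric_series; rewrite ger0_norm ?invr_ge0// invf_lt1// ltr1n.
Qed.

Lemma entire_cvg c x : entire_coef c -> cvgn (pseries c x).
Proof.
move=> ec; apply: normed_cvg; have := @entire_normed_cvg c x ec.
by rewrite /pseries /normed_series_of/=; under [in X in _ -> X]eq_fun do rewrite normrM normrX.
Qed.

Lemma entire_diffs c : entire_coef c -> entire_coef (pseries_diffs c).
Proof.
(* Halving the ratio pays for the factor n + 1, since n + 1 <= 2^(n + 1). *)
move=> ec rho rho0; have rho20 : 0 < rho / 2 by rewrite divr_gt0.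
have [C HC] := ec _ rho20; exists (C * rho) => n.
rewrite /pseries_diffs normrM ger0_norm//.
have C0 : 0 <= C by have := le_trans (normr_ge0 _) (HC 0%N); rewrite expr0 mulr1.
apply: le_trans (ler_wpM2l _ (HC n.+1)) _ => //.
rewrite mulrCA -mulrA ler_wpM2l// exprMn -exprS [rho ^+ _ * _]mulrC mulrA.
rewrite ler_piMl ?exprn_ge0 ?(ltW rho0)// exprVn ler_pdivrMr ?exprn_gt0// mul1r.
by have := ltn_expl n.+1 (ltnSn 1); rewrite -natrX ler_nat; exact: ltnW.
Qed.

Lemma entire_is_derive c x : entire_coef c ->
  is_derive x (1 : R) (fun z => limn (pseries c z)) (limn (pseries (pseries_diffs c) x)).
Proof.
move=> ec; apply: (@pseries_snd_diffs _ c (`|x| + 1)).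
- exact: entire_cvg.
- exact/entire_cvg/entire_diffs.
- exact/entire_cvg/entire_diffs/entire_diffs.
- by rewrite [ltRHS]ger0_norm ?addr_ge0// ltrDl.
Qed.

Lemma entire_scale c (a : R) : entire_coef c -> entire_coef (fun n => a ^+ n * c n).
Proof.
move=> ec rho rho0; have r0 : 0 < rho / (`|a| + 1) by rewrite divr_gt0// ltr_wpDl.
have [C HC] := ec _ r0; exists C => n; rewrite normrM normrX.
have C0 : 0 <= C by have := le_trans (normr_ge0 _) (HC 0%N); rewrite expr0 mulr1.
apply: le_trans (ler_wpM2l _ (HC n)) _; first by rewrite exprn_ge0.
rewrite mulrCA ler_wpM2l// -exprMn lerXn2r ?nnegrE ?mulr_ge0 ?(ltW r0) ?(ltW rho0)//.
by rewrite mulrCA ler_piMr ?(ltW rho0)// ler_pdivrMr ?ltr_wpDl// mul1r lerDl.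
Qed.

End entire.

Section mittag_leffler.
Context {R : realType}.
Variable alpha : R.
Hypothesis alpha_gt0 : 0 < alpha.

Definition ml_coef (n : nat) : R := (Gamma (n%:R * alpha + 1))^-1.

Lemma ml_coef_gt0 n : 0 < ml_coef n.
Proof. by rewrite invr_gt0 Gamma_gt0// ltr_wpDl// mulr_ge0// ltW. Qed.

(** [Gamma_ge] is used with [A] such that A^(n alpha) = rho^(- n) for all n, which bounds the
    coefficient by exp(A) rho^n. *)
Lemma entire_ml_coef : entire_coef ml_coef.
Proof.
move=> rho rho0; pose A := rho `^ (- alpha^-1); exists (expR A) => n.
have A0 : 0 < A by exact: powR_gt0.
rewrite ger0_norm ?(ltW (ml_coef_gt0 n))// /ml_coef -[leRHS]invrK lef_pV2.
- have AE : A `^ (n%:R * alpha) = rho ^- n.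
    by rewrite /A -powRrM mulrCA mulNr mulVf ?gt_eqF// mulrN1 powRN powR_mulrn// ltW.
  by rewrite invfM -expRN mulrC -AE Gamma_ge// mulr_ge0// ltW.
- by rewrite posrE Gamma_gt0// ltr_wpDl// mulr_ge0// ltW.
- by rewrite posrE invr_gt0 mulr_gt0 ?expR_gt0 ?exprn_gt0.
Qed.

Lemma mittag_lefflerE x : mittag_leffler alpha 1 x = limn (pseries ml_coef x).
Proof.
rewrite /mittag_leffler /pseries; congr (limn (series _)).
by apply/funext => n; rewrite mulrC.
Qed.

(** Moving a factor into the coefficients lets either one serve as series variable: the power of
    time for the Caputo derivative, the exponent for the moments. *)
Lemma mittag_leffler_scale a x :
  mittag_leffler alpha 1 (a * x) = limn (pseries (fun n => a ^+ n * ml_coef n) x).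
Proof.
rewrite mittag_lefflerE /pseries; congr (limn (series _)).
by apply/funext => n /=; rewrite exprMn; ring.
Qed.

End mittag_leffler.

Lemma mittag_leffler_exp (R : realType) (x : R) : mittag_leffler 1 1 x = expR x.
Proof.
rewrite /mittag_leffler /expR; congr (limn (series _)).
by apply/funext => n; rewrite mulr1 Gamma_nat /exp_coeff.
Qed.

Lemma series_exp_coeff_le (R : realType) (z : R) n : 0 <= z -> series (exp_coeff z) n <= expR z.
Proof.
move=> z0; apply: nondecreasing_cvgn_le; last exact: is_cvg_series_exp_coeff.
apply/nondecreasing_seqP => m; rewrite /series/= big_nat_recr//= lerDl.
by rewrite /exp_coeff/= divr_ge0// exprn_ge0.
Qed.

Lemma normr_series_exp_coeff_le (R : realType) (z : R) n :
  `|series (exp_coeff z) n| <= series (exp_coeff `|z|) n.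
Proof.
rewrite /series/=; apply: le_trans (ler_norm_sum _ _ _) _; apply: ler_sum => i _.
by rewrite /exp_coeff/= normrM normrX [`|_^-1|]ger0_norm.
Qed.

(** * Exponential moments of a nonnegative variable from its power moments *)

Section exponential_moment.
Context d (T : measurableType d) (R : realType) (P : probability T R).
Variables (Y : T -> R) (c : nat -> R).
Hypothesis mY : measurable_fun [set: T] Y.
Hypothesis Y_ge0 : forall w, 0 <= Y w.
Hypothesis c_entire : entire_coef c.
Hypothesis Y_moment : forall n, (\int[P]_w (Y w ^+ n)%:E = (n`!%:R * c n)%:E)%E.

Let integrableX n : P.-integrable setT (fun w => (Y w ^+ n)%:E).
Proof.
apply/integrableP; split; first exact/measurable_EFinP/measurable_funX.
under eq_integral => w _ do rewrite gee0_abs ?lee_fin ?exprn_ge0//.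
by rewrite Y_moment ltry.
Qed.

Let term_integrable x n : P.-integrable setT (fun w => (exp_coeff (x * Y w) n)%:E).
Proof.
rewrite (_ : (fun _ => _) = (fun w => (x ^+ n / n`!%:R)%:E * (Y w ^+ n)%:E)%E).
  exact: integrableZl.
by apply/funext => w; rewrite -EFinM /exp_coeff/= exprMn mulrAC.
Qed.

Let term_integral x n : (\int[P]_w (exp_coeff (x * Y w) n)%:E = (c n * x ^+ n)%:E)%E.
Proof.
rewrite (eq_integral (fun w => (x ^+ n / n`!%:R)%:E * (Y w ^+ n)%:E)%E); last first.
  by move=> w _; rewrite -EFinM /exp_coeff/= exprMn mulrAC.
rewrite integralZl// Y_moment -EFinM; congr (_%:E).
by rewrite mulrA divfK ?pnatr_eq0 -?lt0n ?fact_gt0// mulrC.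
Qed.

Let partial_integral x n :
  (\int[P]_w (series (exp_coeff (x * Y w)) n)%:E = (pseries c x n)%:E)%E.
Proof.
rewrite /pseries /series/= -sumEFin; under eq_bigr do rewrite -term_integral.
by rewrite -integral_sum//; apply: eq_integral => w _; rewrite -sumEFin.
Qed.

Let partial_measurable x n : measurable_fun [set: T] (fun w => series (exp_coeff (x * Y w)) n).
Proof.
apply: measurable_sum => i; apply/measurable_EFinP; exact: measurable_int (term_integrable x i).
Qed.

Let expR_measurable x : measurable_fun [set: T] (fun w => expR (x * Y w)).
Proof. by apply: (@measurableT_comp _ _ _ _ _ _ expR) => //; exact: measurable_funM. Qed.

(** For a nonnegative argument the partial sums of the exponential increase and their integrals are
    partial sums of a convergent series. A negative [x] is dominated by its absolute value. *)
Lemma expR_integrable_of_moments x : P.-integrable setT (fun w => (expR (x * Y w))%:E).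
Proof.
suff H y : 0 <= y -> P.-integrable setT (fun w => (expR (y * Y w))%:E).
  apply: (le_integrable _ _ _ (H `|x| (normr_ge0 x))) => //; first exact/measurable_EFinP.
  move=> w _; rewrite !gee0_abs ?lee_fin ?expR_ge0// ler_expR ler_wpM2r//.
  exact: ler_norm.
move=> y0; apply/integrableP; split; first exact/measurable_EFinP.
under eq_integral => w _ do rewrite gee0_abs ?lee_fin ?expR_ge0//.
have yY w : 0 <= y * Y w by rewrite mulr_ge0.
have cv := @cvg_monotone_convergence _ _ _ P setT measurableT
  (fun n w => (series (exp_coeff (y * Y w)) n)%:E).
have lime w : limn (fun n => (series (exp_coeff (y * Y w)) n)%:E) = (expR (y * Y w))%:E.
  by apply: EFin_lim; exact: is_cvg_series_exp_coeff.
rewrite (eq_integral (fun w => limn (fun n => (series (exp_coeff (y * Y w)) n)%:E))); last by move=> w _; rewrite lime.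
have cv2 : (\int[P]_w (series (exp_coeff (y * Y w)) n)%:E)%E @[n --> \oo] --> (limn (pseries c y))%:E.
  under eq_fun do rewrite partial_integral.
  by apply: cvg_EFin; [exact: nearW|exact: entire_cvg].
rewrite (cvg_unique _ (cv _ _ _) cv2) ?ltry//.
- by move=> n; exact/measurable_EFinP.
- by move=> n w _; rewrite lee_fin sumr_ge0// => i _; rewrite /exp_coeff/= divr_ge0// exprn_ge0.
- move=> w _; apply/nondecreasing_seqP => m; rewrite lee_fin /series/= big_nat_recr//= lerDl.
  by rewrite /exp_coeff/= divr_ge0// exprn_ge0.
Qed.

(** For negative [x] the partial sums are not monotone, but exp(|x| Y) dominates them and is
    integrable by the previous lemma. *)
Lemma integral_expR_of_moments x : (\int[P]_w (expR (x * Y w))%:E = (limn (pseries c x))%:E)%E.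
Proof.
have cv1 : (\int[P]_w (series (exp_coeff (x * Y w)) n)%:E)%E @[n --> \oo] --> (limn (pseries c x))%:E.
  under eq_fun do rewrite partial_integral.
  by apply: cvg_EFin; [exact: nearW|exact: entire_cvg].
have cv2 : (\int[P]_w (series (exp_coeff (x * Y w)) n)%:E)%E @[n --> \oo] -->
    (\int[P]_w (expR (x * Y w))%:E)%E.
  apply: (@dominated_cvg _ _ _ P setT _ _ _ (fun w => (expR (`|x| * Y w))%:E)) => //.
  - by move=> n; exact/measurable_EFinP.
  - by move=> w _; apply: cvg_EFin; [exact: nearW|exact: is_cvg_series_exp_coeff].
  - exact: expR_integrable_of_moments.
  - move=> n w _; rewrite lee_fin; apply: le_trans (normr_series_exp_coeff_le _ _) _.
    by rewrite normrM [`|Y w|]ger0_norm// series_exp_coeff_le// mulr_ge0.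
by apply: cvg_unique cv2 cv1; exact: ereal_hausdorff.
Qed.

End exponential_moment.

(** * Moment generating function and Caputo derivative *)

Section fractional_skellam.
Context d (T : measurableType d) (R : realType) (P : probability T R).
Variables (alpha : R) (k : nat) (lam mu : nat -> R).
Hypothesis alpha_gt0 : 0 < alpha.
Implicit Types S D : R -> T -> R.

Lemma inverse_subordinator_mgf D x t : stable_subordinator P alpha D -> 0 <= t ->
  (\int[P]_w (expR (x * inverse_subordinator D t w))%:E = (mittag_leffler alpha 1 (x * t `^ alpha))%:E)%E.
Proof.
move=> sD t0; rewrite mulrC mittag_leffler_scale; apply: integral_expR_of_moments.
- exact: (measurable_inverse_subordinator sD).
- by move=> w; exact: inverse_subordinator_ge0.
- exact/entire_scale/entire_ml_coef.
- by move=> n; rewrite (inverse_subordinator_moment alpha_gt0 sD)// mulrA.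
Qed.

Lemma fractional_skellam_mgf S u t : generalized_fractional_skellam_process P alpha k lam mu S ->
  0 <= t -> measurable_fun [set: T] (S t) /\
  (\int[P]_w (expR (u * S t w))%:E =
   (mittag_leffler alpha 1 (skellam_exponent k lam mu u * t `^ alpha))%:E)%E.
Proof.
move=> [S0 gspS]; case: eqP => [->|_] SE t0.
  rewrite powRr1// mittag_leffler_exp mulrC; have <- := skellam_mgf gspS u t0.
  have -> : S t = S0 t by apply/funext => w; exact: SE.
  by split => //; exact: skellam_measurable gspS _ t0.
case: SE => D [sD ind SE].
have -> : S t = (fun w => S0 (inverse_subordinator D t w) w) by apply/funext => w; exact: SE.
have mY := measurable_inverse_subordinator sD t.
have Y0 w := inverse_subordinator_ge0 D t w.
split; first exact: (time_change_measurable gspS mY Y0).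
rewrite (time_change_mgf gspS mY Y0) ?inverse_subordinator_mgf//.
- move=> s A B s0 mA mB; apply: ind; exact: process_sigma_algebra_preimage.
- by move=> x; rewrite inverse_subordinator_mgf// ltry.
Qed.

End fractional_skellam.

(** * Caputo derivative of the Mittag-Leffler function *)

Section caputo_mittag_leffler.
Context {R : realType}.
Notation leb := (@lebesgue_measure R).
Variables (alpha c : R).
Hypothesis alpha_gt0 : 0 < alpha.

Let f (s : R) := mittag_leffler alpha 1 (c * s `^ alpha).
Let q (n : nat) := c ^+ n * ml_coef alpha n.

Let entire_q : entire_coef q. Proof. exact/entire_scale/entire_ml_coef. Qed.

(** Differentiation brings down the factor (n + 1) alpha, which the functional equation of Gamma
    absorbs. *)
Let diffs_q n : alpha * pseries_diffs q n = c * (c ^+ n / Gamma (n.+1%:R * alpha)).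
Proof.
have n1a : 0 < n.+1%:R * alpha by rewrite mulr_gt0.
rewrite /pseries_diffs /q /ml_coef GammaS// invfM exprS.
have Gn0 : Gamma (n.+1%:R * alpha) != 0 by rewrite gt_eqF// Gamma_gt0.
by field; rewrite Gn0 gt_eqF//= gt_eqF// ltr_wpDr.
Qed.

(* The derivative of [f] is the sum of these terms. *)
Let f'term (n : nat) (s : R) := c * (c ^+ n / Gamma (n.+1%:R * alpha)) * s `^ (n.+1%:R * alpha - 1).

Let f'termE n (s : R) : 0 < s ->
  f'term n s = alpha * s `^ (alpha - 1) * (pseries_diffs q n * (s `^ alpha) ^+ n).
Proof.
move=> s0; rewrite /f'term -diffs_q -powR_mulrn ?powR_ge0// -powRrM.
rewrite (_ : n.+1%:R * alpha - 1 = (alpha - 1) + alpha * n%:R); last by rewrite -natr1; ring.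
by rewrite gt0_powRD//; ring.
Qed.

Let fE s : f s = limn (pseries q (s `^ alpha)).
Proof. exact: mittag_leffler_scale. Qed.

Let is_derive_f (s : R) : 0 < s ->
  is_derive s (1 : R) f (alpha * s `^ (alpha - 1) * limn (pseries (pseries_diffs q) (s `^ alpha))).
Proof.
move=> s0; rewrite (_ : f = (fun z => limn (pseries q z)) \o (fun s => s `^ alpha)); last first.
  by apply/funext => x; rewrite fE.
have dp : is_derive s 1 (fun s => s `^ alpha) (alpha * s `^ (alpha - 1)) by exact: is_derive1_powR.
have dq := entire_is_derive (s `^ alpha) entire_q.
by rewrite [X in is_derive _ _ _ X]mulrC; exact: is_derive1_comp.
Qed.


Let F (s : R) := alpha * s `^ (alpha - 1) * limn (pseries (pseries_diffs q) (s `^ alpha)).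

Let p N (s : R) := \sum_(0 <= n < N) f'term n s.

Let p_cvg (s : R) : 0 < s -> p ^~ s @ \oo --> F s.
Proof.
move=> s0; have -> : p ^~ s = (fun n => alpha * s `^ (alpha - 1) * pseries (pseries_diffs q) (s `^ alpha) n).
  apply/funext => n; rewrite /p /pseries /series/= big_distrr/=.
  by apply: eq_bigr => i _; rewrite f'termE.
by apply: cvgMr; exact/entire_cvg/entire_diffs.
Qed.

(** Uniform in [N], with the singularity s^(alpha - 1) at 0 that stays integrable against the Caputo
    kernel. The remaining series has nonnegative coefficients, so its value at [t] bounds it on the
    whole interval. *)
Let p_bound (N : nat) (s t : R) : 0 < s -> s <= t ->
  `|p N s| <= alpha * limn (pseries (fun n => `|pseries_diffs q n|) `|t `^ alpha|) * s `^ (alpha - 1).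
Proof.
move=> s0 st; have st' : s `^ alpha <= t `^ alpha by rewrite ge0_ler_powR ?nnegrE// ltW// (lt_le_trans s0).
rewrite /p; under eq_bigr do rewrite f'termE//.
rewrite -big_distrr/= normrM ger0_norm; last by rewrite mulr_ge0 ?powR_ge0// ltW.
rewrite [leRHS]mulrAC ler_wpM2l//; first by rewrite mulr_ge0 ?powR_ge0// ltW.
apply: le_trans (ler_norm_sum _ _ _) _.
apply: (@le_trans _ _ (pseries (fun n => `|pseries_diffs q n|) `|t `^ alpha| N)).
  apply: ler_sum => i _; rewrite normrM ler_wpM2l// normrX lerXn2r ?nnegrE//.
  by rewrite !ger0_norm ?powR_ge0.
apply: nondecreasing_cvgn_le; last exact/entire_normed_cvg/entire_diffs.
apply/nondecreasing_seqP => m; rewrite /pseries /series/= big_nat_recr//= lerDl.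
by rewrite mulr_ge0.
Qed.

Hypothesis alpha_lt1 : alpha < 1.

Let itv_gt0 (t s : R) : [set` `]0, t[] s -> 0 < s /\ s < t.
Proof. by rewrite /= in_itv/= => /andP[]. Qed.

Let mF (t : R) : measurable_fun `]0, t[ F.
Proof.
apply: measurable_funM; first by apply: measurable_funM => //; exact: measurable_fun_powR.
apply/measurable_funTS.
apply: (@measurableT_comp _ _ _ _ _ _ (fun z => limn (pseries (pseries_diffs q) z))).
  apply: continuous_measurable_fun => z; apply: is_derive_continuous.
  exact/entire_is_derive/entire_diffs.
exact: measurable_powR.
Qed.

Let kernel_integrable (t a : R) : 0 < t -> 0 < a ->
  leb.-integrable `]0, t[ (fun s => (s `^ (a - 1) * (t - s) `^ (- alpha))%:E).
Proof.
move=> t0 a0; apply/integrableP; split.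
  apply/measurable_EFinP/measurable_funM; first exact: measurable_fun_powR.
  by apply: measurable_fun_powR; exact: measurable_funB.
under eq_integral => s _ do rewrite gee0_abs ?lee_fin ?mulr_ge0 ?powR_ge0//.
have := @integral_beta R a (1 - alpha) t a0 _ t0; rewrite subr_gt0 alpha_lt1 => /(_ isT).
by rewrite addrAC subrr add0r => ->; rewrite ltry.
Qed.

Let term_kernelE (t s : R) n : ((f'term n s * (t - s) `^ (- alpha))%:E =
  (c * (c ^+ n / Gamma (n.+1%:R * alpha)))%:E *
    (s `^ (n.+1%:R * alpha - 1) * (t - s) `^ (- alpha))%:E)%E.
Proof. by rewrite -EFinM /f'term -mulrA. Qed.

Let p_kernelE (t s : R) N : ((p N s * (t - s) `^ (- alpha))%:E =
  \sum_(0 <= n < N) (f'term n s * (t - s) `^ (- alpha))%:E)%E.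
Proof. by rewrite sumEFin big_distrl. Qed.

Let term_integrable (t : R) n : 0 < t ->
  leb.-integrable `]0, t[ (fun s => (f'term n s * (t - s) `^ (- alpha))%:E).
Proof.
move=> t0; rewrite (funext (fun s => term_kernelE t s n)).
by apply: integrableZl => //; apply: kernel_integrable => //; rewrite mulr_gt0.
Qed.

(** The Beta parameters (n + 1) alpha and 1 - alpha add up to n alpha + 1. Hence Gamma((n + 1)
    alpha) cancels, and the derivative of term n + 1 is carried to a multiple of term n. *)
Let term_integral (t : R) n : 0 < t ->
  (\int[leb]_(s in `]0%R, t[) (f'term n s * (t - s) `^ (- alpha))%:E =
   (c * Gamma (1 - alpha) * (q n * (t `^ alpha) ^+ n))%:E)%E.
Proof.
move=> t0; have n1a : 0 < n.+1%:R * alpha by rewrite mulr_gt0.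
under eq_integral do rewrite term_kernelE.
rewrite integralZl//; last exact: kernel_integrable.
have := @integral_beta R (n.+1%:R * alpha) (1 - alpha) t n1a _ t0.
rewrite subr_gt0 alpha_lt1 => /(_ isT).
rewrite (_ : 1 - alpha - 1 = - alpha); last by ring.
move=> ->; rewrite -EFinM; congr (_%:E).
rewrite (_ : _ * alpha + (1 - alpha) = n%:R * alpha + 1); last by rewrite -natr1; ring.
rewrite addrK /q /ml_coef -(powR_mulrn n (powR_ge0 t alpha)) -powRrM [alpha * _]mulrC.
have G1 : Gamma (n.+1%:R * alpha) != 0 by rewrite gt_eqF// Gamma_gt0.
have G2 : Gamma (n%:R * alpha + 1) != 0.
  by rewrite gt_eqF// Gamma_gt0// ltr_wpDl// mulr_ge0// ltW.
move: G1 G2; move: (Gamma _) (Gamma _) (Gamma _) (_ `^ _) (_ ^+ _) => x y z v w x0 z0.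
by field; rewrite x0 z0.
Qed.

Let p_integral (t : R) N : 0 < t ->
  (\int[leb]_(s in `]0%R, t[) (p N s * (t - s) `^ (- alpha))%:E =
   (c * Gamma (1 - alpha) * pseries q (t `^ alpha) N)%:E)%E.
Proof.
move=> t0; under eq_integral do rewrite p_kernelE.
rewrite integral_sum//; last by move=> n; exact: term_integrable.
under eq_bigr do rewrite term_integral//.
by rewrite sumEFin -big_distrr.
Qed.

Let dominator (t s : R) := ((alpha * limn (pseries (fun n => `|pseries_diffs q n|) `|t `^ alpha|))%:E *
   (s `^ (alpha - 1) * (t - s) `^ (- alpha))%:E)%E.

Let dominator_integrable (t : R) : 0 < t -> leb.-integrable `]0, t[ (dominator t).
Proof.
move=> t0.
by apply: integrableZl => //; exact: kernel_integrable.
Qed.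

Let p_le_dominator N (t s : R) : [set` `]0, t[] s ->
  (`|(p N s * (t - s) `^ (- alpha))%:E| <= dominator t s)%E.
Proof.
move=> /itv_gt0 [s0 st]; rewrite /dominator -EFinM lee_fin normrM [X in _ * X]ger0_norm ?powR_ge0//.
by rewrite mulrA ler_wpM2r ?powR_ge0// p_bound// ltW.
Qed.

Let p_kernel_cvg (t s : R) : [set` `]0, t[] s ->
  (p N s * (t - s) `^ (- alpha))%:E @[N --> \oo] --> (F s * (t - s) `^ (- alpha))%:E.
Proof.
move=> /itv_gt0 [s0 st]; apply: cvg_EFin; first exact: nearW.
by apply: cvgMl; exact: p_cvg.
Qed.

Let mker (t : R) : measurable_fun `]0, t[ (fun s => (t - s) `^ (- alpha)).
Proof. by apply: measurable_fun_powR; exact: measurable_funB. Qed.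

Let F_integrable (t : R) : 0 < t ->
  leb.-integrable `]0, t[ (fun s => (F s * (t - s) `^ (- alpha))%:E).
Proof.
move=> t0; apply: (le_integrable _ _ _ (dominator_integrable t0)) => //.
  apply/measurable_EFinP/measurable_funM; [exact: (@mF t)|exact: (@mker t)].
move=> s st; have cv := @cvg_abse _ _ eventually_filter _ _ _ (p_kernel_cvg st).
have cd : (dominator t s @[_ --> \oo]) --> dominator t s by exact: cvg_cst.
apply: (le_trans _ (lee_abs _)); apply: (lee_cvg_to cv cd); apply: nearW => N.
exact: p_le_dominator.
Qed.

Let F_integral (t : R) : 0 < t ->
  (\int[leb]_(s in `]0%R, t[) (F s * (t - s) `^ (- alpha))%:E = (c * Gamma (1 - alpha) * f t)%:E)%E.
Proof.
move=> t0.
have cv1 : (\int[leb]_(s in `]0%R, t[) (p N s * (t - s) `^ (- alpha))%:E)%E @[N --> \oo] -->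
    (\int[leb]_(s in `]0%R, t[) (F s * (t - s) `^ (- alpha))%:E)%E.
  apply: (@dominated_cvg _ _ _ leb `]0, t[ _ _ _ (dominator t)) => //.
  - move=> N; apply/measurable_EFinP/measurable_funM; last exact: (@mker t).
    rewrite /p; apply: measurable_sum => n.
    by apply: measurable_funM => //; exact: measurable_fun_powR.
  - by move=> s; exact: p_kernel_cvg.
  - exact: dominator_integrable.
  - by move=> N s; exact: p_le_dominator.
have cv2 : (\int[leb]_(s in `]0%R, t[) (p N s * (t - s) `^ (- alpha))%:E)%E @[N --> \oo] -->
    (c * Gamma (1 - alpha) * f t)%:E.
  under eq_fun do rewrite p_integral//.
  apply: cvg_EFin; first exact: nearW.
  by rewrite fE; apply: cvgMr; exact: entire_cvg.
by apply: cvg_unique cv1 cv2; exact: ereal_hausdorff.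
Qed.

(** [g] is prescribed at positive times only, as the process is unconstrained at negative ones;
    differentiation at a positive time is local. *)
Lemma is_caputo_mittag_leffler_lt1 (g : R -> R) (t : R) :
  (forall s : R, 0 < s -> g s = mittag_leffler alpha 1 (c * s `^ alpha)) -> 0 < t ->
  is_caputo alpha g t (c * g t).
Proof.
move=> gE t0.
have dg (s : R) : 0 < s -> is_derive s (1 : R) g (F s).
  move=> s0; apply: near_eq_is_derive (is_derive_f s0).
  by near=> x; rewrite gE//; near: x; exact: lt_nbhsr.
have g'E (s : R) : [set` `]0, t[] s -> (derive1 g s * (t - s) `^ (- alpha))%:E = (F s * (t - s) `^ (- alpha))%:E.
  by move=> /itv_gt0 [s0 st]; have ? := dg _ s0; rewrite derive1E derive_val.
rewrite /is_caputo /caputo_derivable /caputo lt_eqF//; split; first split.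
- by move=> s /andP[s0 _]; have [] := dg _ s0.
- by apply: eq_integrable (F_integrable t0) => // s; rewrite inE => st; rewrite g'E.
- have -> : \int[leb]_(s in `]0, t[) (derive1 g s * (t - s) `^ (- alpha)) = c * Gamma (1 - alpha) * f t.
    rewrite /Rintegral -[RHS]/(fine (_%:E)) -F_integral//; congr fine.
    by apply: eq_integral => s; rewrite inE => /g'E.
  rewrite gE// -/(f t); field.
  by rewrite gt_eqF// Gamma_gt0// subr_gt0.
Unshelve. all: by end_near. Qed.

End caputo_mittag_leffler.

Lemma is_caputo_mittag_leffler (R : realType) (alpha c t : R) (g : R -> R) :
  0 < alpha -> alpha <= 1 -> 0 < t ->
  (forall s : R, 0 < s -> g s = mittag_leffler alpha 1 (c * s `^ alpha)) ->
  is_caputo alpha g t (c * g t).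
Proof.
move=> a0; rewrite le_eqVlt => /orP[/eqP -> t0 gE|a1 t0 gE]; last exact: is_caputo_mittag_leffler_lt1.
have dg : is_derive t (1 : R) g (c * g t).
  have -> : c * g t = expR (c * t) * c by rewrite gE// powRr1 ?ltW// mittag_leffler_exp mulrC.
  apply: (@near_eq_is_derive _ _ _ (fun s => expR (c * s))).
    near=> x; have x0 : 0 < x by near: x; exact: lt_nbhsr.
    by rewrite gE// powRr1 ?ltW// mittag_leffler_exp.
  apply: (@is_derive1_comp _ expR (fun s => c * s)).
  by apply: is_derive_eq; rewrite /GRing.scale/= mulr1.
rewrite /is_caputo /caputo_derivable /caputo eqxx; split; first by have [] := dg.
by rewrite derive1E derive_val.
Unshelve. all: by end_near. Qed.

(** * Moments from the moment generating function *)

Section vanishing_order.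
Context {R : realType}.
Implicit Types (f g : R -> R) (u : R).

(** One-sided O(u^n) on the fixed interval []0, 1]]: enough to determine polynomial coefficients,
    and no neighbourhood has to be shrunk when such bounds are combined. *)
Definition vanishes_to (n : nat) f := exists C, forall u, 0 < u -> u <= 1 -> `|f u| <= C * u ^+ n.

Lemma eq_vanishes n f g : f =1 g -> vanishes_to n f -> vanishes_to n g.
Proof. by move=> fg [C H]; exists C => u u0 u1; rewrite -fg H. Qed.

Lemma vanishesD n f g : vanishes_to n f -> vanishes_to n g -> vanishes_to n (fun u => f u + g u).
Proof.
move=> [C HC] [D HD]; exists (C + D) => u u0 u1.
by rewrite mulrDl (le_trans (ler_normD _ _))// lerD ?HC ?HD.
Qed.

Lemma vanishesM n m f g :
  vanishes_to n f -> vanishes_to m g -> vanishes_to (n + m) (fun u => f u * g u).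
Proof.
move=> [C HC] [D HD]; exists (C * D) => u u0 u1.
by rewrite exprD mulrACA normrM ler_pM ?HC ?HD.
Qed.

Lemma vanishes_cst (c : R) : vanishes_to 0 (fun=> c).
Proof. by exists `|c| => u _ _; rewrite expr0 mulr1. Qed.

Lemma vanishesZ n (c : R) f : vanishes_to n f -> vanishes_to n (fun u => c * f u).
Proof. exact: (vanishesM (vanishes_cst c)). Qed.

Lemma vanishesB n f g : vanishes_to n f -> vanishes_to n g -> vanishes_to n (fun u => f u - g u).
Proof.
move=> vf /(vanishesZ (-1)) vg; apply: eq_vanishes (vanishesD vf vg) => u.
by rewrite mulN1r.
Qed.

Lemma vanishes_sum n (I : Type) (s : seq I) (F : I -> R -> R) :
  (forall i, vanishes_to n (F i)) -> vanishes_to n (fun u => \sum_(i <- s) F i u).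
Proof.
move=> vF; elim: s => [|i s IH].
  by exists 0 => u _ _; rewrite big_nil normr0 mul0r.
by apply: eq_vanishes (vanishesD (vF i) IH) => u; rewrite big_cons.
Qed.

Lemma vanishes_leq m n f : (m <= n)%N -> vanishes_to n f -> vanishes_to m f.
Proof.
move=> mn [C HC]; exists `|C| => u u0 u1; apply: le_trans (HC u u0 u1) _.
apply: (@le_trans _ _ (`|C| * u ^+ n)); first by rewrite ler_wpM2r ?ler_norm ?exprn_ge0 ?(ltW u0).
by rewrite ler_wpM2l// ler_wiXn2l ?(ltW u0).
Qed.

(** By f^(m+1) - g^(m+1) = f (f^m - g^m) + g^m (f - g), with bounded outer factors. *)
Lemma vanishes_subX n m f g : vanishes_to 0 f -> vanishes_to 0 g ->
  vanishes_to n (fun u => f u - g u) -> vanishes_to n (fun u => f u ^+ m - g u ^+ m).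
Proof.
move=> vf vg vfg; have vX h i : vanishes_to 0 h -> vanishes_to 0 (fun u => h u ^+ i).
  move=> vh; elim: i => [|i IH]; first exact: vanishes_cst.
  by apply: eq_vanishes (vanishesM vh IH) => u; rewrite exprS.
elim: m => [|m IH].
  by exists 0 => u _ _; rewrite !expr0 subrr normr0 mul0r.
have := vanishesD (vanishesM vf IH) (vanishesM (vX _ m vg) vfg).
by rewrite !add0n; apply: eq_vanishes => u; rewrite !exprS; ring.
Qed.

Lemma vanishes_horner (Q : {poly R}) : vanishes_to 0 (fun u => Q.[u]).
Proof.
have [C HC] := poly_disk_bound Q 1; exists C => u u0 u1; rewrite expr0 mulr1 HC//.
by rewrite ger0_norm ?(ltW u0).
Qed.

(** Letting u tend to 0 kills the constant coefficient; what remains is divisible by u, and the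
    division lowers the order by one. *)
Lemma coef_vanishes (Q : {poly R}) n j : vanishes_to n (fun u => Q.[u]) -> (j < n)%N -> Q`_j = 0.
Proof.
elim/poly_ind: Q n j => [|Q c IH] n j; first by rewrite coef0.
case: n => [//|n] vQ jn.
have c0 : c = 0.
  have vX : vanishes_to 1 (fun u : R => u) by exists 1 => u u0 _; rewrite expr1 mul1r ger0_norm ?(ltW u0).
  have : vanishes_to 1 (fun=> c).
    have := vanishesB (vanishes_leq (ltn0Sn n) vQ) (vanishesM (vanishes_horner Q) vX).
    by apply: eq_vanishes => u; rewrite !hornerE; ring.
  move=> [C HC]; apply/eqP; rewrite -normr_le0; apply/ler_addgt0Pl => e e0; rewrite addr0.
  have C0 : 0 <= C by have := HC 1 ltr01 (lexx 1); rewrite expr1 mulr1; exact: le_trans.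
  (* Small enough for C u <= e while staying in []0, 1]]; the 1 added to [C] allows [C = 0]. *)
  pose u := Num.min 1 (e / (C + 1)).
  have u0 : 0 < u by rewrite lt_min ltr01 divr_gt0// ltr_wpDl.
  apply: le_trans (HC u u0 _) _; first by rewrite ge_min lexx.
  rewrite expr1; apply: (@le_trans _ _ (C * (e / (C + 1)))).
    by rewrite ler_wpM2l// ge_min lexx orbT.
  by rewrite mulrCA ler_piMr ?(ltW e0)// ler_pdivrMr ?ltr_wpDl// mul1r lerDl.
move: vQ jn; rewrite c0 addr0 => vQ; case: j => [|j] jn; rewrite coefMX//=.
apply: (IH n) => //; case: vQ => C HC; exists C => u u0 u1.
have := HC u u0 u1; rewrite hornerMX normrM [`|u|]ger0_norm ?(ltW u0)// exprSr mulrA.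
by rewrite ler_pM2r.
Qed.

(** For n >= r the n-th term is at most |c n| K^n u^r, because u^n <= u^r on [[0, 1]]. *)
Lemma entire_remainder (c : nat -> R) (K u y : R) (r : nat) :
  entire_coef c -> 0 <= u -> u <= 1 -> 0 <= K -> `|y| <= K * u ->
  `|limn (pseries c y) - \sum_(0 <= n < r) c n * y ^+ n| <=
    limn (pseries (fun n => `|c n|) K) * u ^+ r.
Proof.
move=> ec u0 u1 K0 yK.
have cK : cvgn (pseries (fun n => `|c n|) K).
  by have := @entire_normed_cvg _ _ K ec; rewrite ger0_norm.
have cv : `|pseries c y N - \sum_(0 <= n < r) c n * y ^+ n| @[N --> \oo] -->
   `|limn (pseries c y) - \sum_(0 <= n < r) c n * y ^+ n|.
  by apply: cvg_norm; apply: cvgB; [exact: entire_cvg|exact: cvg_cst].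
rewrite -(cvg_lim _ cv)//; apply: limr_le; first by apply/cvg_ex; eexists; exact: cv.
near=> N; have rN : (r <= N)%N by near: N; exact: nbhs_infty_ge.
rewrite /pseries/= /series/= (@big_cat_nat _ _ _ r 0%N N)//= addrAC subrr add0r.
apply: le_trans (ler_norm_sum _ _ _) _.
apply: (@le_trans _ _ (\sum_(r <= n < N) `|c n| * K ^+ n * u ^+ r)).
  rewrite big_nat_cond [leRHS]big_nat_cond; apply: ler_sum => n /andP[/andP[rn _] _].
  rewrite normrM normrX -mulrA ler_wpM2l//.
  apply: (@le_trans _ _ ((K * u) ^+ n)); first by rewrite lerXn2r ?nnegrE ?mulr_ge0.
  by rewrite exprMn ler_wpM2l ?exprn_ge0// ler_wiXn2l.
rewrite -big_distrl/= ler_wpM2r ?exprn_ge0//.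
apply: (@le_trans _ _ (pseries (fun n => `|c n|) K N)).
  rewrite /pseries/series/= (@big_cat_nat _ _ _ r 0%N N)//= lerDr sumr_ge0// => i _.
  by rewrite mulr_ge0 ?exprn_ge0.
apply: nondecreasing_cvgn_le => //; apply/nondecreasing_seqP => m.
by rewrite /pseries /series/= big_nat_recr//= lerDl mulr_ge0 ?exprn_ge0.
Unshelve. all: by end_near. Qed.

End vanishing_order.

(** Distributing the power turns monomials into choice functions [m] whose degree is the sum of the
    parts; zero parts are still allowed here. *)
Lemma coef_poly_exp (R : comNzRingType) (a : nat -> R) (n r : nat) :
  ((\poly_(m < r.+1) a m) ^+ n)`_r =
  \sum_(m : {ffun 'I_n -> 'I_r.+1} | (\sum_(l < n) m l == r)%N) \prod_(l < n) a (m l).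
Proof.
rewrite poly_def -[n in LHS]card_ord -prodr_const bigA_distr_bigA/= coef_sum [RHS]big_mkcond/=.
apply: eq_bigr => m _.
have -> : \prod_(i < n) (a (m i) *: 'X^(m i)) = (\prod_(l < n) a (m l)) *: 'X^(\sum_(l < n) m l).
  by rewrite scaler_prod prodrXr.
by rewrite coefZ coefXn eq_sym; case: eqP => _; rewrite ?mulr1 ?mulr0.
Qed.

Section exponential_expansion.
Context {R : realType}.

Lemma entire_inv_fact : entire_coef (fun n => (n`!%:R)^-1 : R).
Proof.
rewrite (_ : (fun _ => _) = ml_coef 1); first exact: entire_ml_coef.
by apply/funext => n; rewrite /ml_coef mulr1 Gamma_nat.
Qed.

Lemma expR_remainder (x u : R) r : 0 <= u -> u <= 1 ->
  `|expR (u * x) - \sum_(0 <= n < r) (n`!%:R)^-1 * (u * x) ^+ n| <= expR `|x| * u ^+ r.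
Proof.
move=> u0 u1; have := @entire_remainder R _ `|x| u (u * x) r entire_inv_fact u0 u1 (normr_ge0 x).
rewrite normrM ger0_norm// mulrC => /(_ (lexx _)).
rewrite -[limn (pseries _ (u * x))]/((fun z => limn (pseries (fun n => (n`!%:R)^-1) z)) (u * x)).
rewrite -expRE; under [X in pseries X `|x|]eq_fun do rewrite ger0_norm ?invr_ge0//.
rewrite -[limn (pseries _ `|x|)]/((fun z => limn (pseries (fun n => (n`!%:R)^-1) z)) `|x|).
by rewrite -expRE.
Qed.

(** The Taylor coefficients of [skellam_exponent] at 0. At [m = 0] the general formula would give
    the total of all rates, whereas the exponent vanishes at 0, hence the special case. *)
Definition skellam_coef (k : nat) (lam mu : nat -> R) (m : nat) : R :=
  if m == 0%N then 0 else
  (m`!%:R)^-1 * \sum_(1 <= j < k.+1) (j%:R ^+ m * lam j + (-1) ^+ m * j%:R ^+ m * mu j).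

Lemma skellam_exponent_vanishes k (lam mu : nat -> R) r :
  vanishes_to r.+1 (fun u => skellam_exponent k lam mu u -
    (\poly_(m < r.+1) skellam_coef k lam mu m).[u]).
Proof.
pose rem (x : R) (u : R) := expR (u * x) - \sum_(0 <= n < r.+1) (n`!%:R)^-1 * (u * x) ^+ n.
have vrem x : vanishes_to r.+1 (rem x).
  by exists (expR `|x|) => u u0 u1; apply: expR_remainder => //; exact: ltW.
have : vanishes_to r.+1 (fun u => \sum_(1 <= j < k.+1) (lam j * rem j%:R u + mu j * rem (- j%:R) u)).
  by apply: vanishes_sum => j; apply: vanishesD; apply: vanishesZ.
apply: eq_vanishes => u; rewrite /skellam_exponent horner_poly.
rewrite big_ord_recl [skellam_coef _ _ _ _]/= mul0r add0r.
transitivity (\sum_(1 <= j < k.+1)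
  ((lam j * (expR (u * j%:R) - 1) + mu j * (expR (- (u * j%:R)) - 1)) -
  \sum_(i < r) ((i.+1)`!%:R)^-1 * (j%:R ^+ i.+1 * lam j + (-1) ^+ i.+1 * j%:R ^+ i.+1 * mu j) * u ^+ i.+1)).
  apply: eq_bigr => j _; rewrite /rem mulrN !big_nat_recl//= !expr0 fact0 invr1 !mulr1 !big_mkord.
  transitivity (lam j * (expR (u * j%:R) - 1) + mu j * (expR (- (u * j%:R)) - 1) -
     (lam j * (\sum_(i < r) ((i.+1)`!%:R)^-1 * (u * j%:R) ^+ i.+1) +
      mu j * (\sum_(i < r) ((i.+1)`!%:R)^-1 * (- (u * j%:R)) ^+ i.+1))); first by ring.
  congr (_ - _); rewrite !big_distrr/= -big_split/=; apply: eq_bigr => i _.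
  by rewrite [(- (u * _)) ^+ _]exprNn !exprMn; ring.
rewrite big_split/= sumrN; congr (_ - _); rewrite exchange_big/=; apply: eq_bigr => i _.
by rewrite /skellam_coef/= -big_distrl/= -big_distrr.
Qed.

End exponential_expansion.

Section moments.
Context d (T : measurableType d) (R : realType) (P : probability T R).
Variable X : T -> R.
Hypothesis mX : measurable_fun [set: T] X.
Hypothesis expX : forall u : R, P.-integrable setT (fun w => (expR (u * X w))%:E).

(** Exponential moments at 1 and -1 suffice, since exp(|x|) <= exp(x) + exp(- x). *)
Let expN_integrable : P.-integrable setT (fun w => (expR `|X w|)%:E).
Proof.
apply: (le_integrable _ _ _ (integrableD measurableT (expX 1) (expX (-1)))) => //.
  by apply/measurable_EFinP; apply: (@measurableT_comp _ _ _ _ _ _ expR) => //; exact: measurableT_comp.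
move=> w _; rewrite -EFinD !gee0_abs ?lee_fin ?addr_ge0 ?expR_ge0// mul1r mulN1r.
by case: (ger0P (X w)) => _; rewrite ?lerDl ?lerDr expR_ge0.
Qed.

(** The quotient |x|^n / n! is a single term of the nonnegative series of exp(|x|). *)
Lemma moment_integrable n : P.-integrable setT (fun w => (X w ^+ n)%:E).
Proof.
have Z := integrableZl measurableT n`!%:R expN_integrable.
apply: (le_integrable _ _ _ Z) => //; first exact/measurable_EFinP/measurable_funX.
move=> w _; rewrite -EFinM [leRHS]gee0_abs ?lee_fin ?mulr_ge0 ?expR_ge0// normrX.
rewrite mulrC -ler_pdivrMr ?ltr0n ?fact_gt0//.
apply: (@le_trans _ _ (series (exp_coeff `|X w|) n.+1)); last exact: series_exp_coeff_le.
by rewrite /series/= big_nat_recr//= /exp_coeff/= lerDr sumr_ge0.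
Qed.

Let m n := fine (\int[P]_w (X w ^+ n)%:E)%E.

(** The pathwise Taylor remainder is at most exp(|X|) u^r, an integrable variable times a
    deterministic power, so integration preserves the order in u. *)
Lemma mgf_taylor_vanishes r :
  vanishes_to r (fun u => fine (\int[P]_w (expR (u * X w))%:E)%E -
    (\poly_(n < r) ((n`!%:R)^-1 * fine (\int[P]_w (X w ^+ n)%:E)%E)).[u]).
Proof.
pose B := fine (\int[P]_w (expR `|X w|)%:E)%E; exists B => u u0 u1.
pose A w := \sum_(0 <= n < r) (n`!%:R)^-1 * (u * X w) ^+ n.
have AE w : (A w)%:E = (\sum_(0 <= n < r) (u ^+ n / n`!%:R)%:E * (X w ^+ n)%:E)%E.
  rewrite -sumEFin; apply: eq_bigr => n _; rewrite -EFinM exprMn; congr (_%:E); ring.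
have Aint : P.-integrable setT (fun w => (A w)%:E).
  under eq_fun do rewrite AE.
  by apply: integrable_sum => // n _; apply: integrableZl => //; exact: moment_integrable.
have AI : fine (\int[P]_w (A w)%:E)%E = (\poly_(n < r) ((n`!%:R)^-1 * m n)).[u].
  under eq_integral do rewrite AE.
  rewrite integral_sum//; last by move=> n; apply: integrableZl => //; exact: moment_integrable.
  under eq_bigr => n _.
    rewrite integralZl//; last exact: moment_integrable.
    rewrite -[(\int[P]_w _)%E]fineK; last by apply: integrable_fin_num => //; exact: moment_integrable.
    rewrite -EFinM; over.
  rewrite sumEFin/= horner_poly big_mkord; apply: eq_bigr => n _.
  by rewrite -/(m n); ring.
rewrite -AI.
have -> : fine (\int[P]_w (expR (u * X w))%:E)%E - fine (\int[P]_w (A w)%:E)%E =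
    \int[P]_w (expR (u * X w) - A w).
  by rewrite RintegralB//; exact: expX.
have I : P.-integrable setT (EFin \o (fun w => expR (u * X w) - A w)).
  by apply: (@integrableB _ _ _ P setT _ (fun w => (expR (u * X w))%:E) (fun w => (A w)%:E)).
apply: le_trans (le_normr_Rintegral measurableT I) _.
have -> : B * u ^+ r = \int[P]_w (expR `|X w| * u ^+ r) by rewrite RintegralZr.
apply: le_Rintegral => //.
- exact: integrable_norm.
- exact: (integrableZr measurableT (u ^+ r) expN_integrable).
- by move=> w _; apply: expR_remainder => //; exact: ltW.
Qed.

End moments.

(** [skellam_coef] is 0 at 0, so a choice with a zero part contributes nothing. *)
Lemma sum_prod_skellam_coef (R : realType) (k : nat) (lam mu : nat -> R) (n r : nat) :
  \sum_(m : {ffun 'I_n -> 'I_r.+1} | (\sum_(l < n) m l == r)%N)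
    \prod_(l < n) skellam_coef k lam mu (m l) =
  \sum_(m : {ffun 'I_n -> 'I_r.+1} | (\sum_(l < n) m l == r)%N && [forall l, (0 < m l)%N])
    \prod_(l < n)
      ((m l)`!%:R^-1 *
       \sum_(1 <= j < k.+1) (j%:R ^+ m l * lam j + (-1) ^+ m l * j%:R ^+ m l * mu j)).
Proof.
rewrite big_mkcondr/=; apply: eq_bigr => m _; case: ifPn => [/forallP m0|].
  by apply: eq_bigr => l _; rewrite /skellam_coef gtn_eqF.
by rewrite negb_forall => /existsP[l]; rewrite -eqn0Ngt => ml; rewrite (bigD1 l)//= /skellam_coef ml mul0r.
Qed.

Section fractional_skellam_moments.
Context d (T : measurableType d) (R : realType) (P : probability T R).
Variables (alpha : R) (k : nat) (lam mu : nat -> R) (X : T -> R) (z : R).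
Hypothesis alpha_gt0 : 0 < alpha.
Hypothesis mX : measurable_fun [set: T] X.
Hypothesis mgfX : forall u, (\int[P]_w (expR (u * X w))%:E =
   (mittag_leffler alpha 1 (skellam_exponent k lam mu u * z))%:E)%E.

Let psi := skellam_exponent k lam mu.
Let p r := \poly_(m < r.+1) skellam_coef k lam mu m.
Let c n := z ^+ n * ml_coef alpha n.

Let expX u : P.-integrable setT (fun w => (expR (u * X w))%:E).
Proof.
apply/integrableP; split.
  apply/measurable_EFinP; apply: (@measurableT_comp _ _ _ _ _ _ expR) => //.
  exact: measurable_funM.
by under eq_integral => w _ do rewrite gee0_abs ?lee_fin ?expR_ge0//; rewrite mgfX ltry.
Qed.

Let psi_vanishes : vanishes_to 1 psi.
Proof.
apply: eq_vanishes (skellam_exponent_vanishes k lam mu 0) => u.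
by rewrite horner_poly big_ord1 mul0r subr0.
Qed.

(** Since the exponent is O(u), cutting the Mittag-Leffler series after the power [r] costs
    O(u^(r+1)); replacing the exponent by its Taylor polynomial in each remaining power costs the
    same order. *)
Lemma mgf_vanishes r : vanishes_to r.+1 (fun u => fine (\int[P]_w (expR (u * X w))%:E)%E -
  (\sum_(0 <= n < r.+1) c n *: p r ^+ n).[u]).
Proof.
have psi0 : vanishes_to 0 psi by exact: vanishes_leq psi_vanishes.
have vX n : vanishes_to r.+1 (fun u => c n * (psi u ^+ n - (p r).[u] ^+ n)).
  apply/vanishesZ/vanishes_subX => //; first exact: vanishes_horner.
  exact: skellam_exponent_vanishes.
have vS := @vanishes_sum R r.+1 _ (index_iota 0 r.+1) _ vX.
have vM : vanishes_to r.+1 (fun u => fine (\int[P]_w (expR (u * X w))%:E)%E -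
    \sum_(0 <= n < r.+1) c n * psi u ^+ n).
  have [K HK] := psi_vanishes.
  have K0 : 0 <= K by have := HK 1 ltr01 (lexx 1); rewrite expr1 mulr1; exact: le_trans.
  exists (limn (pseries (fun n => `|c n|) K)) => u u0 u1.
  rewrite mgfX mulrC mittag_leffler_scale; apply: entire_remainder => //.
  - exact/entire_scale/entire_ml_coef.
  - exact: ltW.
  - by have := HK u u0 u1; rewrite expr1.
apply: eq_vanishes (vanishesD vM vS) => u; rewrite horner_sum.
rewrite [X in _ + X](eq_bigr (fun n => c n * psi u ^+ n - c n * (p r).[u] ^+ n)); last by move=> n _; rewrite mulrBr.
rewrite sumrB addrA subrK; congr (_ - _).
by apply: eq_bigr => n _; rewrite hornerZ horner_exp.
Qed.

Lemma moment_of_mgf r : (\int[P]_w (X w ^+ r)%:E =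
  (r`!%:R * \sum_(0 <= n < r.+1) c n * (p r ^+ n)`_r)%:E)%E.
Proof.
have vQ := vanishesB (mgf_taylor_vanishes mX expX r.+1) (mgf_vanishes r).
set t := \poly_(n < r.+1) _ in vQ; set q := \sum_(_ <= _ < _) _ in vQ.
have /eqP : (q - t)`_r = 0.
  apply: (@coef_vanishes _ (q - t) r.+1 r) => //.
  by apply: eq_vanishes vQ => u; rewrite hornerD hornerN; ring.
rewrite coefB subr_eq0 coef_poly ltnSn coef_sum => /eqP qt.
rewrite -[LHS]fineK; last by apply: integrable_fin_num => //; exact: moment_integrable.
congr (_%:E); under eq_bigr do rewrite -coefZ; by rewrite qt mulrA mulfV ?mul1r.
Qed.

End fractional_skellam_moments.

Theorem mainTheorem18 (d : measure_display) (T : measurableType d)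
    (R : realType) (P : probability T R)
    (alpha : R) (k : nat) (lam mu : nat -> R) (S : R -> T -> R)
    (alpha_gt0 : 0 < alpha) (alpha_le1 : alpha <= 1)
    (k_gt0 : (0 < k)%N)
    (lam_gt0 : forall j, (1 <= j <= k)%N -> 0 < lam j)
    (mu_gt0 : forall j, (1 <= j <= k)%N -> 0 < mu j)
    (S_gfsp : generalized_fractional_skellam_process P alpha k lam mu S) :
  [/\ (forall u t : R, 0 <= t ->
         'M_P (S t) u =
         (mittag_leffler alpha 1
            (skellam_exponent k lam mu u * t `^ alpha))%:E),
      (forall u : R,
         (forall t : R, 0 < t ->
            is_caputo alpha (fun s : R => fine ('M_P (S s) u)) t
              (skellam_exponent k lam mu u * fine ('M_P (S t) u))) /\
         'M_P (S 0) u = 1%E)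
    & (forall (r : nat) (t : R), (0 < r)%N -> 0 <= t ->
         'E_P[fun w => (S t w ^+ r)%R]%E =
         (r`!%:R * \sum_(1 <= n < r.+1)
            t `^ (n%:R * alpha) / Gamma (n%:R * alpha + 1) *
            \sum_(m : {ffun 'I_n -> 'I_r.+1}
                  | (\sum_(l < n) m l == r)%N && [forall l, (0 < m l)%N])
              \prod_(l < n)
                ((m l)`!%:R^-1 *
                 \sum_(1 <= j < k.+1)
                   (j%:R ^+ m l * lam j
                    + (-1) ^+ m l * j%:R ^+ m l * mu j)))%:E)].
Proof.
have mgf u t : 0 <= t -> 'M_P (S t) u = (mittag_leffler alpha 1
    (skellam_exponent k lam mu u * t `^ alpha))%:E.
  move=> t0; rewrite -(fractional_skellam_mgf alpha_gt0 u S_gfsp t0).2 /mmt_gen_fun unlock.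
  by apply: eq_integral => w _; rewrite /= mulrC.
split => // [u|r t r0 t0].
  split=> [t t0|].
    apply: (@is_caputo_mittag_leffler _ _ _ _ (fun s => fine ('M_P (S s) u))) => // s s0.
    by rewrite mgf// ltW.
  (* The time power is 0 at [t = 0], so only the term of index 0 survives, equal to 1 / Gamma(1) =
     1. *)
  rewrite mgf// powR0 ?gt_eqF// mittag_lefflerE mulr0 /pseries.
  congr (_%:E); apply: (@cvg_lim _ (@Rhausdorff R)); apply: cvg_near_cst.
  exists 1%N => // n /= n1; rewrite /series/= big_ltn//= big1_seq ?addr0.
    by rewrite /ml_coef mul0r (@Gamma_nat R 0) fact0 invr1 mulr1.
  move=> i /andP[_]; rewrite mem_index_iota => /andP[i1 _].
  by rewrite expr0n gtn_eqF// mulr0.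
have [mS _] := fractional_skellam_mgf alpha_gt0 0 S_gfsp t0.
rewrite unlock (moment_of_mgf alpha_gt0 mS (fun u => (fractional_skellam_mgf alpha_gt0 u S_gfsp t0).2)).
(* The term [n = 0] drops out: the zeroth power is the polynomial 1, whose coefficient of index
   [r > 0] is 0. *)
congr ((_ * _)%:E); rewrite big_ltn// expr0 coef1 gtn_eqF// [X in X + _]mulr0 add0r.
apply: eq_bigr => n _; rewrite coef_poly_exp sum_prod_skellam_coef; congr (_ * _).
by rewrite /ml_coef -(powR_mulrn n (powR_ge0 t alpha)) -powRrM [alpha * _]mulrC.
Qed.
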